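(* Let $q=p^n$ for an odd prime $p$ and $n\geqslant 1$, and let $m\geqslant 1$. Then the following statements hold. (i) Let $U<\mathbf{Z}(q^{1+2m}_+)\cong\mathbb{F}_{q}^+$ be a proper subgroup, let $d$ be a divisor of $n$ and let $q_0=p^d$. Then $U$ is a subfield hyperplane of $\mathbf{Z}(q_{+}^{1+2m})\cong \mathbb{F}_{q}^+$ with respect to $\mathbb{F}_{q_0}$ if and only if $$q^{1+2m}_{+}/U\cong (q_0)^{1+2mn/d}_{+}.$$ In particular, for any subgroup $U<\mathbf{Z}(q^{1+2m}_+)$ of order $p^{n-1}$, we have $q^{1+2m}_{+}/U\cong p^{1+2mn}_{+}$. (ii) $q^{1+2}_{+}\cong \mathrm{SL}(3,q)_p\cong \mathrm{SU}(3,q)_p$. (iii) $q^{1+2m}_{+}\cong \mathbf{O}_p(G_\alpha)$, where $G=\mathrm{PSp}(2m+2,q)$ acts naturally on the $1$-dimensional subspaces of $\mathbb{F}_{q}^{2m+2}$ and $G_\alpha$ is the stabilizer of such a subspace $\alpha$.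
   Context: For $q=p^n$ with $p$ an odd prime, $q^{1+2}_+$ is the group of all upper unitriangular $3\times 3$ matrices over $\mathbb{F}_q$, and $q^{1+2m}_+$ is the central product of $m$ copies of it, namely $(q^{1+2}_+)^m/C$ with $C=\{(X_1,\dots,X_m)\in\mathbf{Z}(q^{1+2}_+)^m : X_1\cdots X_m=1\}$; likewise $(q_0)^{1+2k}_+$ for any power $q_0$ of $p$ and any $k\geqslant1$. The center of $q^{1+2m}_+$ is identified with the additive group $\mathbb{F}_q^+$, where $c\in\mathbb{F}_q$ corresponds to the image of $\begin{pmatrix}1&0&c\\0&1&0\\0&0&1\end{pmatrix}$ from any one of the components. For a divisor $d$ of $n$, a subfield hyperplane of $\mathbb{F}_{p^n}^+$ with respect to $\mathbb{F}_{p^d}$ is an $\mathbb{F}_{p^d}$-subspace of $\mathbb{F}_{p^n}$ of codimension $1$ over $\mathbb{F}_{p^d}$ (equivalently, an $\mathbb{F}_p$-subspace of dimension $n-d$ invariant under multiplication by $\mathbb{F}_{p^d}^\times$). $X_p$ denotes a Sylow $p$-subgroup of $X$, and $\mathbf{O}_p(X)$ the largest normal $p$-subgroup of $X$. *)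

(* Defs.v *)
From HB Require Import structures.
From mathcomp Require Import all_boot all_order all_fingroup all_algebra.
From mathcomp Require Import all_solvable all_field all_character.

Set Implicit Arguments.
Unset Strict Implicit.
Unset Printing Implicit Defensive.

Import GroupScope GRing.Theory.
Local Open Scope ring_scope.

(* The central product H^m / C of m copies of a group H, amalgamating the
   whole center; C is [cpower_ker]. *)
Section CentralPower.

Variables (gT : finGroupType) (m : nat) (H : {group gT}).

Let gTm := {dffun forall i : 'I_m, gT}.

Definition cpower_ker : {set gTm} :=
  [set X in setXn (fun _ : 'I_m => 'Z(H)) |
    (\prod_(i < m) (X : gTm) i)%g == 1%g].

Fact cpower_ker_group_set : group_set cpower_ker.
Proof.
apply/group_setP; split=> [|X Y].
  rewrite inE; apply/andP; split; last by rewrite big1 // => i _; rewrite ffunE.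
  by apply/setXnP=> i; rewrite ffunE; apply: group1.
move=> /setIdP[/setXnP ZX /eqP pX] /setIdP[/setXnP ZY /eqP pY].
apply/setIdP; split; first by apply/setXnP=> i; rewrite mulg_ffun groupM.
suff -> : (\prod_(i < m) ((X * Y)%g : gTm) i
           = (\prod_(i < m) X i) * (\prod_(i < m) Y i))%g.
  by rewrite pX pY mulg1.
pose P (a b c : gT) := [/\ a \in 'Z(H), b \in 'Z(H)
                                & c = (a * b)%g].
have [] // : P (\prod_(i < m) X i)%g (\prod_(i < m) Y i)%g
               (\prod_(i < m) (X * Y)%g i)%g.
apply: (big_rec3 P); first by split; rewrite ?group1 ?mulg1.
move=> i a b c _ [Za Zb ->]; split; rewrite ?groupM ?ZX ?ZY //.
rewrite ffunE -!mulgA; congr (_ * _)%g; rewrite !mulgA; congr (_ * _)%g.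
have /setIP[_ /centP cY] := ZY i.
by apply: cY; have /setIP[] := Za.
Qed.

Canonical cpower_ker_group := Group cpower_ker_group_set.

(* Naming this structure keeps its inference at concrete gT tractable. *)
Definition cpower_type : finGroupType := coset_of cpower_ker.

Definition cpower : {set cpower_type} :=
  (setXn (fun _ : 'I_m => H : {set gT}) / cpower_ker)%g.

Canonical cpower_group := Eval hnf in [group of cpower].

(* The image in the central product of x, taken in the i-th component. *)
Definition cpower_elt (i : 'I_m) (x : gT) : cpower_type :=
  coset cpower_ker (dfung1 (i := i) x : gTm).

End CentralPower.

Section Unitriangular.

Variable F : finFieldType.

(* The group q^{1+2}_+ with q = #|F|. *)
Definition unitri3 : {set {'GL_3[F]}} :=
  [set g : {'GL_3[F]} |
    [forall i : 'I_3, [forall j : 'I_3,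
      (j <= i)%N ==> (GLval g i j == (i == j)%:R)]]].

Lemma unitri3P (g : {'GL_3[F]}) :
  reflect (forall i j : 'I_3, (j <= i)%N -> GLval g i j = (i == j)%:R)
          (g \in unitri3).
Proof.
rewrite inE; apply: (iffP forallP) => [H i j le_ji | H i].
  by have /forallP/(_ j)/implyP/(_ le_ji)/eqP := H i.
by apply/forallP=> j; apply/implyP=> le_ji; apply/eqP; apply: H.
Qed.

Fact unitri3_group_set : group_set unitri3.
Proof.
apply/group_setP; split=> [|g h /unitri3P Hg /unitri3P Hh].
  by apply/unitri3P=> i j _; rewrite GL_1E mxE.
apply/unitri3P=> i j le_ji; rewrite GL_MxE mxE (bigD1 i) //= big1 => [|k ki].
  by rewrite addr0 Hg // Hh // eqxx mul1r.
have [lt_ki | le_ik] := ltnP k i.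
  by rewrite Hg ?(ltnW lt_ki) // eq_sym (negPf ki) mul0r.
by rewrite Hh ?(leq_trans le_ji) // -val_eqE /= gtn_eqF ?mulr0 //
           (leq_ltn_trans le_ji) // ltn_neqAle le_ik eq_sym val_eqE ki.
Qed.

Canonical unitri3_group := Group unitri3_group_set.

Definition corner_mx (c : F) : 'M[F]_3 := 1%:M + c *: delta_mx ord0 ord_max.

Fact corner_mx_unit (c : F) : corner_mx c \is a GRing.unit.
Proof.
suff e : corner_mx c * corner_mx (- c) = 1.
  by apply/unitrP; exists (corner_mx (- c)); split=> //; apply/mulmx1C.
rewrite /corner_mx -[LHS]/(_ *m _) mulmxDl mul1mx mulmxDr mulmx1.
rewrite -scalemxAl -scalemxAr mul_delta_mx_0 // !scaler0 addr0.
by rewrite scaleNr subrK.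
Qed.

Definition corner (c : F) : {'GL_3[F]} := FinRing.Unit (corner_mx_unit c).

(* The group q^{1+2m}_+ with q = #|F|. *)
Definition extraspec_type (m : nat) : finGroupType :=
  cpower_type m unitri3_group.

Definition extraspec (m : nat) : {set extraspec_type m} :=
  cpower m unitri3_group.

Canonical extraspec_group m := Eval hnf in [group of extraspec m].

(* U, viewed as a subset of F under the identification of c : F with the image
   of [corner c] in the central product; this image does not depend on i. *)
Definition center_preim (m : nat) (i : 'I_m)
    (U : {set extraspec_type m}) : {set F} :=
  [set c | cpower_elt unitri3_group i (corner c) \in U].

End Unitriangular.

Section LinearGroups.

Variables (F : finFieldType) (n : nat).

Definition SL : {set {'GL_n[F]}} := [set g | \det (GLval g) == 1].

Fact SL_group_set : group_set SL.
Proof.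
apply/group_setP; split=> [|g h]; first by rewrite inE GL_1E det1.
by rewrite !inE GL_MxE det_mulmx => /eqP-> /eqP->; rewrite mulr1.
Qed.

Canonical SL_group := Group SL_group_set.

(* SU(n, q) when #|F| = q ^ 2: the special isometry group of the standard
   Hermitian form, whose Gram matrix is the identity; x |-> x ^+ q is the
   involutory automorphism of F. *)
Definition SU (q : nat) : {set {'GL_n[F]}} :=
  [set g in SL |
    GLval g *m (map_mx (fun x => x ^+ q) (GLval g))^T == 1%:M].

End LinearGroups.

Section Symplectic.

Variables (F : finFieldType) (k : nat).

Local Notation N := (k.+1 + k.+1)%N.

Definition symp_gram : 'M[F]_N := block_mx 0 1%:M (- 1%:M) 0.

(* Sp(2k+2, q), acting on row vectors from the right. *)
Definition Sp : {set {'GL_N[F]}} :=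
  [set g : {'GL_N[F]} |
    (GLval g : 'M_N) *m symp_gram *m (GLval g : 'M_N)^T == symp_gram].

Fact Sp_group_set : group_set Sp.
Proof.
apply/group_setP; split=> [|g h].
  by rewrite inE GL_1E (trmx1 F N) (mul1mx (symp_gram : 'M_N)) mulmx1.
rewrite !inE => /eqP Hg /eqP Hh; apply/eqP.
rewrite -[RHS]Hg -[in RHS]Hh.
by rewrite GL_MxE (trmx_mul (GLval g : 'M_N) (GLval h : 'M_N)) !mulmxA.
Qed.

Canonical Sp_group := Group Sp_group_set.

(* PSp(2k+2, q) *)
Definition PSp : {set coset_of 'Z(Sp)} := (Sp / 'Z(Sp))%g.

Canonical PSp_group := Eval hnf in [group of PSp].

(* The action of GL(2k+2, q) / Z(Sp(2k+2, q)), hence of its subgroup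
   PSp(2k+2, q), on sets of row vectors that is induced by u |-> u *m g; the
   set of vectors of a subspace is fixed by 'Z(Sp), as 'Z(Sp) consists of
   scalar matrices. *)
Definition PGL_act := (('MR (GLrepr F (k + k.+1)))^* %% 'Z(Sp)%G)%act.

Definition PSp_stab (A : {vspace 'rV[F]_N}) : {set coset_of 'Z(Sp)} :=
  'C_PSp[[set u : 'rV[F]_N | u \in A] | PGL_act].

Canonical PSp_stab_group A := Eval hnf in [group of PSp_stab A].

End Symplectic.

(* V is a subspace of F of codimension 1 over the subfield of order p ^ d;
   this subfield K is unique, and exists iff d divides the degree of F. Here F
   is viewed as an extension of 'F_p, so \dim K is the degree of K over 'F_p,
   while \dim W and \dim {:fieldOver K} are dimensions over K. *)
Definition subfield_hyperplane (F : finFieldType) (p : nat)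
    (chF : p \in [pchar F]) (d : nat) (V : {set F}) : Prop :=
  exists2 K : {subfield pPrimeCharType chF}, \dim K = d &
  exists2 W : {vspace fieldOver K},
    (\dim W + 1 = \dim {:fieldOver K})%N &
    forall x : F, (x \in V) = ((x : fieldOver K) \in W).

(* Main.v *)
Require Import Defs.
From HB Require Import structures.
From mathcomp Require Import all_boot all_order all_fingroup all_algebra.
From mathcomp Require Import all_solvable all_field all_character.
From mathcomp Require Import ring.

(** Every group in the statement is compared with one explicit multiplication
    on F^m x F^m x F, namely [hmul],
      (x, y, z)(x', y', z') = (x + x', y + y', z + z' + x.y').
    A central product of unitriangular groups is the image of this magma under
    an injective multiplicative map ([extraspec_cover]), and two groups covered
    by the same magma with the same fibres are isomorphic ([isog_of_covers]), so
    each isomorphism amounts to exhibiting coordinates.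

    (i) The quotient by a central subgroup U, seen as an additive subgroup V of
    F, replaces x.y by its class modulo V. If V is a hyperplane over the subfield
    K of order p ^ d, choose a K-linear functional l on F with kernel V and a
    K-basis e_j of F: then l (x y) is the dot product over K of the vectors
    l (x e_j) and y_j, where the y_j are the coordinates of y
    ([hyperplane_pairing]), and both vectors determine the element they come from
    because V is not all of F. Applied to each coordinate, this turns the
    quotient into the group over K of rank m n / d. Conversely, an isomorphism
    with a group over F0 induces an additive bijection tau between F^2m and
    F0^2m0 that respects commutation: the symplectic pairing of v and w lies in V
    exactly when tau v and tau w are orthogonal. Multiplication by c in F0,
    transported by tau, preserves orthogonality over F, hence every line of F^2m,
    hence is multiplication by some f c in F; f is a field embedding and V is
    stable under its image ([centroid_embedding]). Comparing orders gives the
    codimension.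

    (ii) The unitriangular matrices are a Sylow subgroup of GL(3, F), which
    settles SL. For SU, an explicit basis turns the standard Hermitian form into
    the antidiagonal one; the unitriangular isometries of the latter have
    coordinates in F obeying [hmul] ([SU_anti_unitri3_cover]). A larger p-subgroup
    would still fix a vector, which must be the isotropic vector fixed by all
    these isometries, and this forces it to be unitriangular
    ([unitri3_SU_anti_Sylow]).

    (iii) The isometries that fix v and act trivially on v^perp / v are the
    Siegel transformations, which again have coordinates obeying [hmul]. They
    form a normal p-subgroup Q of the stabilizer of the line of v. The p-core R
    of the stabilizer contains Q, and Q / Z(Q) meets the center of R / Z(Q), so
    R fixes modulo v some vector of v^perp outside the line of v; transvections
    move this vector to any other such vector, so R acts trivially on
    v^perp / v and R = Q ([pcore_line_stab]). The center of Sp has exponent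
    dividing 2, so passing to PSp leaves the p-core unchanged. *)

Set Implicit Arguments.
Unset Strict Implicit.
Unset Printing Implicit Defensive.

Import GroupScope GRing.Theory.
Local Open Scope nat_scope.

(** * A multiplication covering all the groups *)

(** A presentation of G as a multiplicative image: [op] is not required to be
    a group law, which spares the verification of the group axioms on T. *)
Definition magma_cover (T : Type) (op : T -> T -> T) (gT : finGroupType)
    (G : {set gT}) (f : T -> gT) : Prop :=
  [/\ forall t, f t \in G, forall x, x \in G -> exists t, x = f t
    & forall a b, f (op a b) = (f a * f b)%g].

(** Equal fibres make f t |-> g t well defined and injective. *)
Lemma isog_of_covers (T : Type) (op : T -> T -> T) (gT hT : finGroupType)
    (G : {group gT}) (H : {group hT}) (f : T -> gT) (g : T -> hT) :
    magma_cover op G f -> magma_cover op H g ->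
    (forall a b, f a = f b <-> g a = g b) ->
  G \isog H.
Proof.
move=> [fG Gf fM] [gH Hg gM] fg.
have /fin_all_exists[h hP] (x : gT) : exists y : hT, x \in G ->
    forall t, f t = x -> g t = y.
  have [/Gf[t ->]|] := boolP (x \in G); last by exists 1%g.
  by exists (g t) => _ s /fg.
have hf t : h (f t) = g t by rewrite (hP (f t) (fG t) t).
have hM : {in G &, {morph h : x y / (x * y)%g}}.
  by move=> _ _ /Gf[a ->] /Gf[b ->]; rewrite -fM !hf gM.
apply/isogP; exists (Morphism hM); last first.
  apply/setP=> y; apply/morphimP/idP => [[_ _ /Gf[t ->] ->]|/Hg[t ->]].
    by rewrite /= hf.
  by exists (f t); rewrite ?fG //= hf.
by apply/injmP=> _ _ /Gf[a ->] /Gf[b ->] /=; rewrite !hf => /fg.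
Qed.

Section Heisenberg.
Local Open Scope ring_scope.
Variables (F : finFieldType) (m : nat).

(** The underlying set of the Heisenberg group of rank m over F. *)
Definition heis : Type := ('rV[F]_m * 'rV[F]_m * F)%type.
Definition Heis x y z : heis := (x, y, z).

Definition dot (x y : 'rV[F]_m) : F := \sum_i x 0 i * y 0 i.

Definition hmul (a b : heis) : heis :=
  Heis (a.1.1 + b.1.1) (a.1.2 + b.1.2) (a.2 + b.2 + dot a.1.1 b.1.2).

Lemma dotDl x x' y : dot (x + x') y = dot x y + dot x' y.
Proof. by rewrite -big_split; apply: eq_bigr => i _; rewrite mxE mulrDl. Qed.

Lemma dotDr x y y' : dot x (y + y') = dot x y + dot x y'.
Proof. by rewrite -big_split; apply: eq_bigr => i _; rewrite mxE mulrDr. Qed.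

Lemma dotZl c x y : dot (c *: x) y = c * dot x y.
Proof. by rewrite mulr_sumr; apply: eq_bigr => i _; rewrite mxE mulrA. Qed.

Lemma dotZr c x y : dot x (c *: y) = c * dot x y.
Proof. by rewrite mulr_sumr; apply: eq_bigr => i _; rewrite mxE mulrCA. Qed.

Lemma dotC x y : dot x y = dot y x.
Proof. by apply: eq_bigr => i _; rewrite mulrC. Qed.

Lemma dot0l y : dot 0 y = 0.
Proof. by rewrite -(scale0r 0) dotZl mul0r. Qed.

Lemma dot0r x : dot x 0 = 0.
Proof. by rewrite dotC dot0l. Qed.

Lemma dot_delta x i : dot x (delta_mx 0 i) = x 0 i.
Proof.
rewrite /dot (bigD1 i) //= big1 => [|j ji]; rewrite mxE eqxx /=.
  by rewrite eqxx mulr1 addr0.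
by rewrite (negPf ji) mulr0.
Qed.

End Heisenberg.

Section UnitriangularParam.
Local Open Scope ring_scope.
Variable F : finFieldType.
Implicit Types a b c : F.

Definition u3_mx a b c : 'M[F]_3 :=
  \matrix_(i, j) (if i == j then 1 else
    if (i == 0 :> nat) && (j == 1 :> nat) then a else
    if (i == 1 :> nat) && (j == 2 :> nat) then b else
    if (i == 0 :> nat) && (j == 2 :> nat) then c else 0).

(** Reduces an identity between 3 x 3 matrices to its nine entries. *)
Lemma ord3P (P : 'I_3 -> Prop) :
  P ord0 -> P (lift ord0 ord0) -> P ord_max -> forall i, P i.
Proof.
move=> P0 P1 P2 [[|[|[|k]]] Hk] //.
- by rewrite (_ : Ordinal _ = ord0) //; apply: val_inj.
- by rewrite (_ : Ordinal _ = lift ord0 ord0) //; apply: val_inj.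
by rewrite (_ : Ordinal _ = ord_max) //; apply: val_inj.
Qed.

Lemma sum3 (f : 'I_3 -> F) :
  \sum_i f i = f ord0 + f (lift ord0 ord0) + f ord_max.
Proof.
by rewrite !big_ord_recl big_ord0 addr0 addrA; congr (_ + f _); apply: val_inj.
Qed.

Lemma u3_mxM a b c a' b' c' :
  u3_mx a b c *m u3_mx a' b' c' = u3_mx (a + a') (b + b') (c + c' + a * b').
Proof. by apply/matrixP; do 2!apply: ord3P; rewrite !mxE sum3 !mxE /=; ring. Qed.

Lemma u3_mx0 : u3_mx 0 0 0 = 1%:M.
Proof. by apply/matrixP; do 2!apply: ord3P; rewrite !mxE. Qed.

Fact u3_mx_unit a b c : u3_mx a b c \is a GRing.unit.
Proof.
have e : u3_mx a b c *m u3_mx (- a) (- b) (a * b - c) = 1%:M.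
  by rewrite u3_mxM -u3_mx0; congr u3_mx; ring.
by apply/unitrP; exists (u3_mx (- a) (- b) (a * b - c)); split=> //; apply/mulmx1C.
Qed.

Definition u3 a b c : {'GL_3[F]} := FinRing.Unit (u3_mx_unit a b c).

Lemma u3M a b c a' b' c' :
  (u3 a b c * u3 a' b' c')%g = u3 (a + a') (b + b') (c + c' + a * b').
Proof. by apply: val_inj; apply: u3_mxM. Qed.

Lemma u3_inj a b c a' b' c' :
  u3 a b c = u3 a' b' c' -> [/\ a = a', b = b' & c = c'].
Proof.
move/(congr1 val)/matrixP => e; split.
- by have := e ord0 (lift ord0 ord0); rewrite !mxE.
- by have := e (lift ord0 ord0) ord_max; rewrite !mxE.
by have := e ord0 ord_max; rewrite !mxE.
Qed.

Lemma mem_u3 a b c : u3 a b c \in unitri3 F.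
Proof.
by apply/unitri3P; do 2!apply: ord3P; rewrite //= !mxE.
Qed.

Lemma unitri3_u3 g : g \in unitri3 F -> exists a b c, g = u3 a b c.
Proof.
move/unitri3P=> gU; exists (GLval g ord0 (lift ord0 ord0)).
exists (GLval g (lift ord0 ord0) ord_max), (GLval g ord0 ord_max).
apply: val_inj; apply/matrixP; do 2!apply: ord3P; rewrite !mxE //=;
 by rewrite gU.
Qed.

Lemma u3_1 : u3 0 0 0 = 1%g.
Proof. by apply: val_inj; rewrite /= u3_mx0. Qed.

Lemma corner_u3 c : corner c = u3 0 0 c.
Proof.
apply: val_inj; rewrite /= /corner_mx.
by apply/matrixP; do 2!apply: ord3P; rewrite !mxE /=; ring.
Qed.

Lemma u3_center a b c : (u3 a b c \in 'Z(unitri3_group F)) = (a == 0) && (b == 0).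
Proof.
apply/idP/andP=> [/centerP[_ cU]|[/eqP-> /eqP->]].
  have comm x y : c + 0 + a * y = 0 + c + x * b.
    by have := cU _ (mem_u3 x y 0); rewrite /commute !u3M => /u3_inj[].
  have := comm 0 1; have := comm 1 0.
  rewrite !mulr0 !mulr1 !mul0r mul1r !addr0 !add0r => e1 e2.
  by split; apply/eqP/(addrI c); rewrite addr0.
apply/centerP; split=> [|x]; first exact: mem_u3.
by case/unitri3_u3=> a' [b' [c' ->]]; rewrite /commute !u3M; congr u3; ring.
Qed.

Lemma unitri3_cover :
  magma_cover (@hmul F 1) (unitri3 F) (fun t => u3 (t.1.1 0 0) (t.1.2 0 0) t.2).
Proof.
split=> [t|x|a b]; first exact: mem_u3.
  case/unitri3_u3=> a [b [c ->]].
  by exists (Heis (const_mx a) (const_mx b) c); rewrite /= !mxE.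
by rewrite u3M /= !mxE /dot big_ord1.
Qed.

End UnitriangularParam.

Section CentralPowerElements.
Local Open Scope group_scope.
Variables (gT : finGroupType) (m : nat) (H : {group gT}).
Implicit Types X Y : 'I_m -> gT.

Definition tup X : {dffun forall i : 'I_m, gT} := [ffun i => X i].

Definition cpower_class X : cpower_type m H := coset (cpower_ker m H) (tup X).

Lemma cpower_ker_norm X :
  (forall i, X i \in H) -> tup X \in 'N(cpower_ker m H).
Proof.
move=> XH; apply: (subsetP (cent_sub _)); apply/centP=> Y /setIdP[/setXnP ZY _].
apply/ffunP=> i; rewrite !ffunE.
by have /centerP[_ ->] := ZY i.
Qed.

Lemma eq_cpower_class X Y : X =1 Y -> cpower_class X = cpower_class Y.
Proof. by move=> XY; congr coset; apply/ffunP=> i; rewrite !ffunE. Qed.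

Lemma mem_cpower_class X : (forall i, X i \in H) -> cpower_class X \in cpower m H.
Proof.
move=> XH; apply: mem_quotient.
by apply/setXnP=> i; rewrite ffunE.
Qed.

Lemma cpower_classP x : x \in cpower m H ->
  exists2 X, forall i, X i \in H & x = cpower_class X.
Proof.
case/morphimP=> Y _ /setXnP HY ->; exists (fun i => Y i) => //.
by congr coset; apply/ffunP=> i; rewrite ffunE.
Qed.

Lemma cpower_classM X Y : (forall i, X i \in H) -> (forall i, Y i \in H) ->
  cpower_class (fun i => X i * Y i) = cpower_class X * cpower_class Y.
Proof.
move=> XH YH; rewrite -morphM ?cpower_ker_norm //.
by congr coset; apply/ffunP=> i; rewrite !ffunE.
Qed.

(** Classes of m-tuples in the central product are compared through this
    criterion, which unfolds the amalgamated kernel. *)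
Lemma cpower_class1P X : (forall i, X i \in H) ->
  cpower_class X = 1 <-> (forall i, X i \in 'Z(H)) /\ \prod_(i < m) X i = 1.
Proof.
move=> XH.
have -> : \prod_(i < m) X i = \prod_(i < m) tup X i.
  by apply: eq_bigr => i _; rewrite ffunE.
split=> [/(coset_idr (cpower_ker_norm XH))/setIdP[/setXnP ZX /eqP pX]|[ZX pX]].
  by split=> // i; have := ZX i; rewrite ffunE.
apply: coset_id; apply/setIdP; split; last exact/eqP.
by apply/setXnP=> i; rewrite ffunE.
Qed.

Lemma cpower_elt_class i x :
  cpower_elt H i x = cpower_class (fun j => if j == i then x else 1).
Proof.
congr coset; apply/ffunP=> j; rewrite ffunE; have [->|ji] := eqVneq j i.
  by rewrite ffunE eqxx dfwith_in.
by rewrite ffunE (negPf ji) dfwith_out // eq_sym.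
Qed.

End CentralPowerElements.

Section ExtraspecParam.
Local Open Scope ring_scope.
Variables (F : finFieldType) (m : nat) (i0 : 'I_m).
Implicit Types (x y : 'rV[F]_m) (z : F).

(** The corner entry of the product is the sum of the corner entries of the
    factors, so the whole central coordinate may be put in the i0-th factor. *)
Definition extraspec_elt (t : heis F m) : extraspec_type F m :=
  cpower_class (unitri3_group F)
    (fun i => u3 (t.1.1 0 i) (t.1.2 0 i) (if i == i0 then t.2 else 0)).

Lemma prod_u3_center (f : 'I_m -> F) :
  (\prod_(i < m) u3 0 0 (f i))%g = u3 0 0 (\sum_i f i).
Proof.
rewrite (big_morph (u3 0 0) (id1 := 1%g) (op1 := mulg)) ?u3_1 //.
by move=> a b; rewrite u3M !addr0 mul0r addr0.
Qed.

Lemma sum_single (z : F) : \sum_(i < m) (if i == i0 then z else 0) = z.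
Proof. by rewrite -big_mkcond big_pred1_eq. Qed.

Lemma u3_class_eq1 (a b c : 'I_m -> F) :
  cpower_class (unitri3_group F) (fun i => u3 (a i) (b i) (c i)) = 1%g <->
  [/\ forall i, a i = 0, forall i, b i = 0 & \sum_i c i = 0].
Proof.
apply: (iff_trans (cpower_class1P _)) => [i|]; first exact: mem_u3.
split=> [[Z]|[a0 b0 c0]].
  have a0 i : a i = 0 by have := Z i; rewrite u3_center => /andP[/eqP].
  have b0 i : b i = 0 by have := Z i; rewrite u3_center => /andP[_ /eqP].
  under eq_bigr => i _ do rewrite a0 b0.
  by rewrite prod_u3_center -u3_1 => /u3_inj[].
split=> [i|]; first by rewrite u3_center a0 b0 eqxx.
under eq_bigr => i _ do rewrite a0 b0.
by rewrite prod_u3_center c0 u3_1.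
Qed.

(** Dividing one tuple by the other reduces the claim to the trivial class:
    only the sum of the corner entries survives in the central product. *)
Lemma u3_class_eq (a b c a' b' c' : 'I_m -> F) :
  cpower_class (unitri3_group F) (fun i => u3 (a i) (b i) (c i)) =
  cpower_class (unitri3_group F) (fun i => u3 (a' i) (b' i) (c' i)) <->
  [/\ a =1 a', b =1 b' & \sum_i c i = \sum_i c' i].
Proof.
have -> : cpower_class (unitri3_group F) (fun i => u3 (a i) (b i) (c i)) =
  (cpower_class (unitri3_group F) (fun i => u3 (a' i) (b' i) (c' i)) *
   cpower_class (unitri3_group F) (fun i => u3 (a i - a' i) (b i - b' i)
     (c i - c' i - a' i * (b i - b' i))))%g.
  rewrite -cpower_classM; try by move=> i; apply: mem_u3.
  by apply: eq_cpower_class => i; rewrite u3M; congr u3; ring.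
rewrite -[X in _ = X]mulg1; split=> [/mulgI/u3_class_eq1[ea eb ec]|[ea eb ec]].
  have {}ea i : a i = a' i by apply/eqP; rewrite -subr_eq0 ea.
  split=> // [i|]; first by apply/eqP; rewrite -subr_eq0 eb.
  apply/eqP; rewrite -subr_eq0 -[X in _ == X]ec -sumrB; apply/eqP.
  by apply: eq_bigr => i _; rewrite eb mulr0 subr0.
congr (_ * _)%g; apply/u3_class_eq1; split=> [i|i|].
- by rewrite ea subrr.
- by rewrite eb subrr.
rewrite (eq_bigr (fun i => c i - c' i)); first by rewrite sumrB ec subrr.
by move=> i _; rewrite eb subrr mulr0 subr0.
Qed.

Lemma extraspec_cover : magma_cover (@hmul F m) (extraspec F m) extraspec_elt.
Proof.
split=> [t|g|s t]; first by apply: mem_cpower_class => i; apply: mem_u3.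
  case/cpower_classP=> X XH ->.
  have /fin_all_exists[x] i := unitri3_u3 (XH i).
  case/fin_all_exists=> y /fin_all_exists[z Xe].
  exists (Heis (\row_i x i) (\row_i y i) (\sum_i z i)).
  rewrite (eq_cpower_class _ Xe); apply/u3_class_eq; split=> [i|i|] /=; rewrite ?mxE //.
  by rewrite sum_single.
rewrite -cpower_classM; try by move=> i; apply: mem_u3.
rewrite -[RHS](eq_cpower_class _ (fun i => esym (u3M _ _ _ _ _ _))).
apply/u3_class_eq; split=> [i|i|] /=; rewrite ?mxE //.
by rewrite sum_single !big_split /= !sum_single.
Qed.

Lemma extraspec_elt_inj : injective extraspec_elt.
Proof.
case=> [[x y] z] [[x' y'] z'] /u3_class_eq[/= ex ey]; rewrite !sum_single => ->.
by congr (_, _, _); apply/rowP.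
Qed.

Lemma mem_extraspec_elt t : extraspec_elt t \in extraspec F m.
Proof. by have [] := extraspec_cover. Qed.

Lemma extraspec_eltM s t : extraspec_elt (hmul s t) = (extraspec_elt s * extraspec_elt t)%g.
Proof. by have [] := extraspec_cover. Qed.

Lemma extraspec_eltP g : g \in extraspec F m -> exists t, g = extraspec_elt t.
Proof. by have [_ /(_ g)] := extraspec_cover. Qed.

(** The commutator of (x, y, z) with the i-th unit vectors has corner entries
    x_i and - y_i. *)
Lemma extraspec_elt_center x y z :
  extraspec_elt (Heis x y z) \in 'Z(extraspec F m) = (x == 0) && (y == 0).
Proof.
apply/idP/andP=> [/centerP[_ cE]|[/eqP-> /eqP->]].
  have c t : hmul (Heis x y z) t = hmul t (Heis x y z).
    by apply: extraspec_elt_inj; rewrite !extraspec_eltM; exact: cE (mem_extraspec_elt t).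
  split; apply/eqP/rowP=> i; rewrite mxE.
    have := c (Heis 0 (delta_mx 0 i) 0).
    rewrite /hmul /= dot_delta dot0l !addr0 !add0r.
    by move/(congr1 snd)=> /= e; apply: (addrI z); rewrite addr0.
  have := c (Heis (delta_mx 0 i) 0 0).
  rewrite /hmul /= dot0r dotC dot_delta !addr0 !add0r.
  by move/(congr1 snd)=> /= e; apply: (addrI z); rewrite addr0.
apply/centerP; split=> [|g]; first exact: mem_extraspec_elt.
case/extraspec_eltP=> [[[x' y'] z'] ->]; rewrite /commute -!extraspec_eltM /hmul /= dot0l dot0r.
by rewrite !add0r !addr0 [z + _]addrC.
Qed.

(** The identification of the center with F does not depend on the component,
    as the sum of the corner entries does not. *)
Lemma cpower_elt_corner i c :
  cpower_elt (unitri3_group F) i (corner c) = extraspec_elt (Heis 0 0 c).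
Proof.
rewrite cpower_elt_class (eq_cpower_class _ (Y := fun j =>
  u3 0 0 (if j == i then c else 0))); last first.
  by move=> j; case: ifP; rewrite ?corner_u3 ?u3_1.
apply/u3_class_eq; split=> [j|j|] /=; rewrite ?mxE // sum_single.
by rewrite -big_mkcond big_pred1_eq.
Qed.

Lemma card_extraspec : #|extraspec F m| = (#|F| ^ (m + m).+1)%N.
Proof.
have -> : extraspec F m = [set extraspec_elt t | t in [set: 'rV[F]_m * 'rV[F]_m * F]].
  apply/setP=> g; apply/idP/imsetP=> [/extraspec_eltP[t ->]|[t _ ->]]; first by exists t.
  exact: mem_extraspec_elt.
rewrite card_imset; last exact: extraspec_elt_inj.
by rewrite cardsT !card_prod card_mx mul1n expnSr expnD.
Qed.

End ExtraspecParam.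

(** * Embeddings of finite fields *)

Section FiniteFieldEmbedding.
Local Open Scope ring_scope.

Lemma finField_generator (E : finFieldType) :
  exists2 g : E, g ^+ #|E|.-1 = 1 /\ g != 0 &
    (forall x, x != 0 -> exists k, x = g ^+ k) /\
    (forall k, g ^+ k = 1 -> (#|E|.-1 %| k)%N).
Proof.
have /cyclicP[u genu] := field_unit_group_cyclic [set: {unit E}]%G.
have ou : #[u]%g = #|E|.-1 by rewrite orderE -genu card_finField_unit.
exists (val u); first by rewrite -FinRing.val_unitX -ou expg_order -unitfE (valP u).
split=> [x x0|k gk].
  have : FinRing.unit E (etrans (unitfE x) x0) \in <[u]>%g by rewrite -genu inE.
  by case/cycleP=> k /(congr1 val) /= ->; exists k; rewrite FinRing.val_unitX.
by rewrite -ou order_dvdn -val_eqE /= FinRing.val_unitX gk.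
Qed.

Lemma two_neq0 (F : finFieldType) (p e : nat) :
  prime p -> odd p -> #|F| = (p ^ e)%N -> 2%:R != 0 :> F.
Proof.
move=> p_pr p_odd oF; rewrite -(dvdn_pcharf (card_finPcharP oF p_pr)).
by rewrite dvdn_prime2 //; apply: contraL p_odd => /eqP->.
Qed.

(** F0 is generated over the prime field by a primitive root g. Since d divides
    n, g satisfies X^#|F| - X, which splits in F; so the minimal polynomial of g
    has a root r in F, and g |-> r extends to a morphism. *)
Lemma finField_embed (p d n : nat) (F0 F : finFieldType) :
  prime p -> (d %| n)%N -> #|F0| = (p ^ d)%N -> #|F| = (p ^ n)%N ->
  exists f : {rmorphism F0 -> F}, True.
Proof.
move=> p_pr /dvdnP[k ->] oF0 oF.
pose ch0 := card_finPcharP oF0 p_pr; pose ch := card_finPcharP oF p_pr.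
pose L0 := pPrimeCharType ch0; pose L := pPrimeCharType ch.
have [g _ [gen _]] := finField_generator F0.
pose ev0 : {rmorphism {poly 'F_p} -> L0} := @horner_alg 'F_p L0 g.
have gk : g ^+ #|F| = g.
  rewrite oF; elim: (k) => [|j IH]; first by rewrite mul0n expr1.
  by rewrite mulSn expnD exprM -oF0 expf_card.
have [q minq] : exists q : {poly 'F_p}, minPoly 1 (g : L0) = map_poly (in_alg L0) q.
  exact/polyOver1P/minPolyOver.
have qP P : ev0 P = 0 -> q %| P.
  move=> P0; rewrite -(dvdp_map (in_alg L0)) -minq minPoly_dvdp //.
    exact: alg_polyOver.
  exact/eqP.
have ev_q : ev0 q = 0.
  by have /eqP := root_minPoly 1 (g : L0); rewrite minq.
have sq : (1 < size q)%N.
  have : (1 < size (minPoly 1 (g : L0)))%N.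
    by rewrite size_minPoly ltnS.
  by rewrite minq size_map_poly.
have : map_poly (in_alg L) q %| \prod_(x <- enum L) ('X - x%:P).
  have -> : \prod_(x <- enum L) ('X - x%:P) = map_poly (in_alg L) ('X^#|F| - 'X).
    by rewrite rmorphB /= map_polyXn map_polyX big_enum -(finField_genPoly F).
  rewrite dvdp_map; apply: qP.
  by rewrite rmorphB rmorphXn /= /ev0 horner_algX gk subrr.
case/dvdp_prod_XsubC=> ms qE.
(* q divides the product of all the X - x, and is not constant. *)
have [r ev_r] : exists r : L, @horner_alg 'F_p L r q = 0.
  case Em: (mask ms (enum L)) qE => [|r s] qE.
    have := eqp_size qE; rewrite big_nil size_poly1 size_map_poly => s1.
    by rewrite s1 in sq.
  exists r; apply/eqP; rewrite -[_ == 0]/(root _ r) (eqp_root qE).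
  by rewrite root_prod_XsubC mem_head.
pose ev : {rmorphism {poly 'F_p} -> L} := @horner_alg 'F_p L r.
have ev_ker P : ev0 P = 0 -> ev P = 0.
  by move/qP/dvdpP=> [Q ->]; rewrite rmorphM /= ev_r mulr0.
have ev_eq P Q : ev0 P = ev0 Q -> ev P = ev Q.
  move=> e; apply/eqP; rewrite -subr_eq0 -rmorphB ev_ker //.
  by rewrite rmorphB /= e subrr.
have surj x : exists P, ev0 P = x.
  have [->|/gen[j ->]] := eqVneq x 0; first by exists 0; rewrite rmorph0.
  by exists 'X^j; rewrite rmorphXn /= /ev0 horner_algX.
have [rep repE] := fin_all_exists surj.
pose f (x : F0) : F := ev (rep x).
have fB : zmod_morphism f.
  move=> x y; rewrite /f -[RHS](rmorphB ev); apply: ev_eq.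
  by rewrite rmorphB /= !repE.
have fM : monoid_morphism f.
  split=> [|x y]; first by rewrite /f -[RHS](rmorph1 ev); apply: ev_eq; rewrite repE rmorph1.
  by rewrite /f -[RHS](rmorphM ev); apply: ev_eq; rewrite rmorphM /= !repE.
pose fa := GRing.isZmodMorphism.Build _ _ f fB.
pose fm := GRing.isMonoidMorphism.Build _ _ f fM.
pose fr : {rmorphism F0 -> F} := HB.pack f fa fm.
by exists fr.
Qed.

End FiniteFieldEmbedding.

(** * Subfield hyperplanes *)

Section SubfieldHyperplane.
Local Open Scope ring_scope.

(** Since F is the direct sum of V and the F0-line of t, there is an F0-linear
    functional l with kernel V and l t = 1. Expanding y on e gives the formula
    with A x := (l (x e_j))_j; and A x = 0 with x != 0 would give l t = 0, by
    taking y = t / x. *)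
Lemma hyperplane_pairing (F F0 : finFieldType) (f : {rmorphism F0 -> F}) (k : nat)
    (V : {set F}) (t : F) (e : 'I_k -> F) (B : F -> 'rV[F0]_k) :
  0 \in V -> {in V &, forall u v, u - v \in V} ->
  (forall c, {in V, forall v, f c * v \in V}) -> t \notin V ->
  (forall x, exists c, x - f c * t \in V) ->
  {morph B : x y / x + y} -> (forall y, y = \sum_j f (B y 0 j) * e j) ->
  exists (A : F -> 'rV[F0]_k) (l : F -> F0),
   [/\ {morph A : x y / x + y}, {morph l : x y / x + y}, injective A,
       forall c, exists x, l x = c & forall x, l x = 0 <-> x \in V] /\
   forall x y, l (x * y) = dot (A x) (B y).
Proof.
move=> V0 WB WM Vt /fin_all_exists[l lP] BD yE.
have WD u v : u \in V -> v \in V -> u + v \in V.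
  by move=> Vu Vv; rewrite -[v]opprK -[- v]sub0r !WB.
(* Uniqueness of the component on t makes l linear. *)
have lU x c : x - f c * t \in V -> l x = c.
  move=> /(WB _ _ (lP x)); have -> : x - f (l x) * t - (x - f c * t) =
    f (c - l x) * t by rewrite rmorphB; ring.
  have [//|nc /(WM (c - l x)^-1)] := eqVneq (l x) c.
  rewrite mulrA -rmorphM mulVf ?subr_eq0 1?eq_sym // rmorph1 mul1r.
  by move/(negP Vt).
have lD : {morph l : x y / x + y}.
  by move=> x y; apply: lU; rewrite rmorphD mulrDl opprD addrACA WD.
have lZ c x : l (f c * x) = c * l x.
  by apply: lU; rewrite rmorphM -mulrA -mulrBr WM.
have lV x : l x = 0 <-> x \in V.
  split=> [lx|Vx]; first by have := lP x; rewrite lx rmorph0 mul0r subr0.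
  by apply: lU; rewrite rmorph0 mul0r subr0.
have l0 : l 0 = 0 by apply/lV.
have lt : l t = 1 by apply: lU; rewrite rmorph1 mul1r subrr.
pose A (x : F) : 'rV[F0]_k := \row_j l (x * e j).
have lAB x y : l (x * y) = dot (A x) (B y).
  rewrite [in LHS](yE y) mulr_sumr (big_morph l lD l0).
  by apply: eq_bigr => j _; rewrite mulrCA lZ mulrC /A [in RHS]mxE.
have AD : {morph A : x y / x + y}.
  by move=> x y; apply/rowP=> j; rewrite !mxE mulrDl lD.
exists A, l; split=> //; split=> //.
  have A0 x : A x = 0 -> x = 0.
    have [//|x0 Ax] := eqVneq x 0.
    have := lAB x (x^-1 * t); rewrite Ax dot0l mulrA mulfV // mul1r lt.
    by move/eqP; rewrite oner_eq0.
  move=> x y xy; apply/eqP; rewrite -subr_eq0; apply/eqP/A0.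
  by apply: (addIr (A y)); rewrite -AD subrK xy add0r.
by move=> c; exists (f c * t); rewrite lZ lt mulr1.
Qed.

(** Over a finite field a subspace can be given as the list of its elements. *)
Lemma mem_span_closed (K : fieldType) (vT : vectType K) (X : seq vT) :
  0 \in X -> (forall a u v, u \in X -> v \in X -> a *: u + v \in X) ->
  <<X>>%VS =i X.
Proof.
move=> X0 XD u; apply/idP/idP=> [|/memv_span //].
move/(@coord_span _ _ _ (in_tuple X))->.
elim/big_rec: _ => // i v _ Xv; apply: XD => //; exact: mem_nth.
Qed.

Variables (F : finFieldType) (p n d : nat) (F0 : finFieldType).
Hypotheses (p_pr : prime p) (oF : #|F| = (p ^ n)%N) (oF0 : #|F0| = (p ^ d)%N).
Variable ch : p \in [pchar F].
Local Notation L := (pPrimeCharType ch).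

Lemma scale_pPrimeChar (a : 'F_p) (x : L) : a *: x = x *+ a.
Proof. exact: mulr_natl. Qed.

Lemma card_dim_exp (V : {vspace L}) : #|V| = (p ^ \dim V)%N.
Proof. by rewrite card_vspace card_Fp. Qed.

Lemma dim_pPrimeChar : \dim {:L} = n.
Proof.
apply/eqP; rewrite -(eqn_exp2l _ _ (prime_gt1 p_pr)) -oF -card_dim_exp.
by apply/eqP; apply: eq_card => x; rewrite memvf.
Qed.

(** The subfield is the image of f. Both it and V are finite sets closed under
    linear combinations, so dimensions can be read off cardinals. *)
Lemma subfield_hyperplane_intro (f : {rmorphism F0 -> F}) (V : {set F}) :
  0 \in V -> {in V &, forall u v, u + v \in V} ->
  (forall c, {in V, forall v, f c * v \in V}) ->
  (#|V| * p ^ d = p ^ n)%N -> subfield_hyperplane ch d V.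
Proof.
move=> V0 VD VM oV.
have VMn v k : v \in V -> v *+ k \in V.
  by move=> Vv; elim: k => [|k IH]; rewrite ?mulr0n // mulrS VD.
pose X : seq L := [seq f x | x <- enum F0].
have XP x : reflect (exists c, x = f c) (x \in X).
  apply: (iffP mapP) => [[c _ ->]|[c ->]]; exists c => //; exact: mem_enum.
have sX : <<X>>%VS =i X.
  apply: mem_span_closed => [|a _ _ /XP[u ->] /XP[v ->]]; apply/XP.
    by exists 0; rewrite rmorph0.
  by exists (u *+ a + v); rewrite scale_pPrimeChar rmorphD rmorphMn.
have aX : is_aspace <<X>>%VS.
  rewrite /is_aspace has_algid1; last first.
    by rewrite sX; apply/XP; exists 1; rewrite rmorph1.
  apply/prodvP=> x y; rewrite !sX => /XP[u ->] /XP[v ->].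
  by apply/XP; exists (u * v); rewrite rmorphM.
pose K : {subfield L} := ASpace aX.
have KX x : (x \in K) = (x \in X) := sX x.
have dimK : \dim K = d.
  apply/eqP; rewrite -(eqn_exp2l _ _ (prime_gt1 p_pr)) -card_dim_exp -oF0.
  rewrite -(card_codom (fmorph_inj f)); apply/eqP; apply: eq_card => x.
  by rewrite KX; apply/XP/codomP.
exists K => //.
have sV : <<enum V : seq L>>%VS =i (enum V : seq L).
  apply: mem_span_closed => [|a u v]; rewrite !mem_enum // => Vu Vv.
  by rewrite scale_pPrimeChar VD ?VMn.
pose VK : {vspace L} := <<enum V : seq L>>%VS.
have KV : (K * VK <= VK)%VS.
  apply/prodvP=> x v; rewrite !sV !mem_enum KX => /XP[c ->].
  exact: VM.
exists (vspaceOver K VK); last first.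
  move=> x; rewrite mem_vspaceOver field_module_eq //.
  by rewrite [RHS]sV mem_enum.
rewrite dim_vspaceOver //.
have -> : {:fieldOver K}%VS = vspaceOver K {:L}.
  apply/vspaceP=> x; rewrite memvf mem_vspaceOver.
  rewrite field_module_eq ?subvf //; exact: esym (@memvf _ L x).
rewrite dim_vspaceOver ?subvf // dim_pPrimeChar dimK.
have d_gt0 : (0 < d)%N by rewrite -dimK adim_gt0.
have <- : (\dim VK + d = n)%N.
  apply/eqP; rewrite -(eqn_exp2l _ _ (prime_gt1 p_pr)) expnD -card_dim_exp -oV.
  apply/eqP; congr (_ * _)%N; apply: eq_card => x.
  by rewrite [LHS]sV mem_enum.
by rewrite divnDr ?dvdnn // divnn d_gt0.
Qed.

(** The subfield of the definition is the image of any embedding of F0, by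
    counting, so that linear algebra over it translates to linear algebra over
    F0. *)
Lemma subfield_hyperplane_pairing (V : {set F}) :
  (d %| n)%N -> subfield_hyperplane ch d V ->
  exists (A B : F -> 'rV[F0]_(n %/ d)) (l : F -> F0),
   [/\ {morph A : x y / x + y}, {morph B : x y / x + y} &
       {morph l : x y / x + y}] /\
   [/\ injective A, injective B, forall c, exists x, l x = c,
       forall x, l x = 0 <-> x \in V
     & forall x y, l (x * y) = dot (A x) (B y)].
Proof.
move=> dn [K dimK [W dimW VW]].
have [f _] := finField_embed p_pr dn oF0 oF.
have f_inj := fmorph_inj f.
have fK c : (f c : L) \in K.
  by rewrite Fermat's_little_theorem card_Fp // dimK -rmorphXn -oF0 expf_card.
have Kf (x : L) : x \in K -> exists c, f c = x.
  move=> Kx; suff /codomP[c ->] : x \in codom f by exists c.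
  have /subset_cardP eK : #|codom f| = #|K|.
    by rewrite card_codom // card_dim_exp dimK.
  suff /eK-> : codom f \subset K by [].
  by apply/subsetP=> _ /codomP[c ->].
have /fin_all_exists[g gP] (x : F) : exists c, (x : L) \in K -> f c = x.
  have [/Kf[c <-]|_] := boolP ((x : L) \in K); last by exists 0.
  by exists c.
have WM c (w : F) : w \in V -> f c * w \in V.
  rewrite !VW => Ww; have /(memvZ (Subvs (fK c))) := Ww.
  by rewrite fieldOver_scaleE.
have WB u v : u \in V -> v \in V -> u - v \in V by rewrite !VW; apply: memvB.
have [t Vt] : exists t, t \notin V.
  apply/existsP; rewrite -negb_forall; apply/negP=> /forallP VT.
  have WT : W = fullv by apply/vspaceP=> x; rewrite memvf -VW VT.
  by move: dimW; rewrite WT addn1 => /esym/n_Sn.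
have Wt : (t : fieldOver K) \notin W by rewrite -VW.
have tW : (<[t : fieldOver K]> + W)%VS = fullv.
  apply/eqP; rewrite eqEdim subvf -dimW addn1.
  rewrite (ltn_leqif (dimv_leqif_sup (addvSr _ _))).
  by rewrite subv_add -memvE negb_and Wt.
have lP (x : F) : exists c, x - f c * t \in V.
  have : (x : fieldOver K) \in (<[t : fieldOver K]> + W)%VS by rewrite tW memvf.
  case/memv_addP=> _ /vlineP[a ->] [w Ww xE].
  have [c cE] := Kf _ (subvsP a).
  exists c; rewrite cE xE fieldOver_scaleE addrC addKr VW //.
have dimL : \dim {:fieldOver K} = (n %/ d)%N.
  have -> : {:fieldOver K}%VS = vspaceOver K {:L}.
    apply/vspaceP=> x; rewrite memvf mem_vspaceOver.
    rewrite field_module_eq ?subvf //; exact: esym (@memvf _ L x).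
  by rewrite dim_vspaceOver ?subvf // dim_pPrimeChar dimK.
have [e [B [BD yE]]] : exists (e : 'I_(n %/ d) -> F) (B : F -> 'rV[F0]_(n %/ d)),
    {morph B : x y / x + y} /\ forall y, y = \sum_j f (B y 0 j) * e j.
  rewrite -dimL; pose e := vbasis {:fieldOver K}.
  (* g inverts f on K, so B y lists the coordinates of y as elements of F0. *)
  pose B (y : F) : 'rV[F0]_(\dim {:fieldOver K}) :=
    \row_j g (vsval (coord e j (y : fieldOver K))).
  have fB (y : F) j : f (B y 0 j) = vsval (coord e j (y : fieldOver K)).
    by rewrite mxE gP // subvsP.
  exists (fun j => e`_j), B; split=> [x y|y].
    apply/rowP=> j; apply: f_inj; rewrite [in RHS]mxE rmorphD.
    by rewrite !fB linearD raddfD.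
  rewrite {1}(coord_vbasis (memvf (y : fieldOver K))).
  by apply: eq_bigr => j _; rewrite fieldOver_scaleE fB.
have V0 : 0 \in V by rewrite VW mem0v.
clear - V0 WB WM Vt lP BD yE.
have [A [l [[AD lD Ai ls lV] lAB]]] := hyperplane_pairing V0 WB WM Vt lP BD yE.
exists A, B, l; split; split=> //.
by move=> x y xy; rewrite (yE x) (yE y) xy.
Qed.

End SubfieldHyperplane.

(** * The symplectic pairing and central quotients *)

Section SymplecticForm.
Local Open Scope ring_scope.
Variables (F : finFieldType) (m : nat).
Local Notation V2 := ('rV[F]_m * 'rV[F]_m)%type.
Implicit Types v w : V2.

(** The commutator pairing of the Heisenberg group. *)
Definition symp v w : F := dot v.1 w.2 - dot w.1 v.2.

Lemma sympDl v v' w : symp (v + v') w = symp v w + symp v' w.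
Proof. by rewrite /symp dotDl dotDr; ring. Qed.

Lemma sympDr v w w' : symp v (w + w') = symp v w + symp v w'.
Proof. by rewrite /symp dotDl dotDr; ring. Qed.

Lemma sympZl a v w : symp (a *: v) w = a * symp v w.
Proof. by rewrite /symp dotZl dotZr; ring. Qed.

Lemma sympZr a v w : symp v (a *: w) = a * symp v w.
Proof. by rewrite /symp dotZl dotZr; ring. Qed.

Lemma symp0l w : symp 0 w = 0.
Proof. by rewrite -(scale0r (0 : V2)) sympZl mul0r. Qed.

Lemma symp_nondegenerate v : (forall w, symp v w = 0) -> v = 0.
Proof.
case: v => x y v0; congr (_, _); apply/rowP=> i; rewrite mxE.
  by have := v0 (0, delta_mx 0 i); rewrite /symp /= dot_delta dot0l subr0.
have := v0 (delta_mx 0 i, 0); rewrite /symp /= dot0r dotC dot_delta sub0r.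
by move/eqP; rewrite oppr_eq0 => /eqP.
Qed.

(** v^perp has codimension at most 1, so a vector orthogonal to it is
    determined by its pairing with one vector outside v^perp. *)
Lemma symp_line u v :
  (forall w, symp v w = 0 -> symp u w = 0) -> exists a, u = a *: v.
Proof.
move=> vu; have [/existsP[w0 vw0] | v0] := boolP [exists w : V2, symp v w != 0].
  exists (symp u w0 / symp v w0).
  apply/eqP; rewrite -subr_eq0; apply/eqP/symp_nondegenerate=> w.
  have : symp v (w + - (symp v w / symp v w0) *: w0) = 0.
    by rewrite sympDr sympZr mulNr divfK // subrr.
  move/vu; rewrite sympDr sympZr sympDl -scaleNr sympZl => <-.
  by congr (_ + _); ring.
exists 0; rewrite scale0r; apply: symp_nondegenerate => w; apply: vu.
by apply/eqP; move: v0; rewrite negb_exists => /forallP/(_ w); rewrite negbK.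
Qed.

(** After subtracting a scalar one may assume f e = 0. If f v = 0 and w is
    independent of v, then f w = f (v + w) is on the lines of w and of v + w, so
    it vanishes; every vector is independent of one of e and e'. *)
Lemma additive_lines_scalar (i : 'I_m) (f : V2 -> V2) :
  {morph f : v w / v + w} -> (forall v, exists a, f v = a *: v) ->
  exists a, forall v, f v = a *: v.
Proof.
move=> fD f_line; pose e : V2 := (delta_mx 0 i, 0); pose e' : V2 := (0, delta_mx 0 i).
have e_free a b : a *: e = b *: e' -> a = 0 /\ b = 0.
  case=> /rowP/(_ i) + /rowP/(_ i); rewrite !mxE !eqxx !mulr1 !mulr0.
  by move=> -> <-.
have [a fe] := f_line e; exists a.
pose g v := f v - a *: v.
have gD : {morph g : v w / v + w}.
  by move=> v w; rewrite /g fD scalerDr opprD addrACA.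
have ge : g e = 0 by rewrite /g fe subrr.
have g_line v : exists b, g v = b *: v.
  by have [b fv] := f_line v; exists (b - a); rewrite /g fv scalerBl.
have g0 v w : g v = 0 -> (forall b c, b *: v = c *: w -> b = 0 /\ c = 0) -> g w = 0.
  move=> gv vw; have [b gw] := g_line w; have [c gvw] := g_line (v + w).
  rewrite gD gv gw add0r scalerDr in gvw.
  have [|c0 bc] := vw c (b - c); first by rewrite scalerBl gvw addrK.
  by rewrite gw -[b](subrK c) bc c0 addr0 scale0r.
(* e and e' are independent, so g vanishes on both. *)
have ge' : g e' = 0 by apply: g0 ge e_free.
move=> v; apply/eqP; rewrite -subr_eq0; apply/eqP; rewrite -/(g v).
have [/existsP[b /eqP->]|] := boolP [exists b, v == b *: e].
  have [->|b0] := eqVneq b 0.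
    by apply: (addIr (g 0)); rewrite scale0r -gD !add0r.
  apply: g0 ge' _ => x y /esym; rewrite scalerA => /e_free[/eqP].
  by rewrite mulf_eq0 (negPf b0) orbF => /eqP.
rewrite negb_exists => /forallP nv; apply: g0 ge _ => x y xy.
have [y0|y0] := eqVneq y 0.
  split=> //; have [] // := e_free x 0.
  by rewrite scale0r xy y0 scale0r.
have /negP[] := nv (y^-1 * x).
by rewrite -scalerA xy scalerA mulVf // scale1r.
Qed.

End SymplecticForm.

Section CentralQuotient.
Local Open Scope ring_scope.
Variables (F : finFieldType) (m : nat) (i0 : 'I_m).
Variable U : {group extraspec_type F m}.
Local Notation E := (extraspec F m).
Hypothesis UZ : U \subset 'Z(E).
Implicit Types (c : F) (s t : heis F m).

Lemma hmul_center c t :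
  hmul (Heis 0 0 c) t = Heis t.1.1 t.1.2 (c + t.2).
Proof. by rewrite /hmul /= dot0l !add0r addr0. Qed.

Lemma Heis_eta t : Heis t.1.1 t.1.2 t.2 = t.
Proof. by case: t => [[]]. Qed.

Lemma central_eltP g : g \in 'Z(E) -> exists c, g = extraspec_elt i0 (Heis 0 0 c).
Proof.
move=> Zg; have [gE _] := centerP _ _ Zg; have [[[x y] z] ge] := extraspec_eltP i0 gE.
by move: Zg; rewrite ge extraspec_elt_center => /andP[/eqP-> /eqP->]; exists z.
Qed.

Lemma central_eltD c c' :
  extraspec_elt i0 (Heis 0 0 (c + c')) =
    (extraspec_elt i0 (Heis 0 0 c) * extraspec_elt i0 (Heis 0 0 c'))%g.
Proof. by rewrite -extraspec_eltM hmul_center. Qed.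

Lemma mem_center_preim i c :
  (c \in center_preim i U) = (extraspec_elt i0 (Heis 0 0 c) \in U).
Proof. by rewrite inE (cpower_elt_corner i0). Qed.

Lemma card_center_preim i : #|center_preim i U| = #|U|.
Proof.
have ext_inj0 : injective (fun c => extraspec_elt i0 (Heis 0 0 c)).
  by move=> c c' /extraspec_elt_inj[].
rewrite -(card_imset _ ext_inj0).
apply: eq_card => g; apply/imsetP/idP=> [[c]|Ug].
  by rewrite mem_center_preim => Uc ->.
have [c ge] := central_eltP (subsetP UZ g Ug); exists c => //.
by rewrite mem_center_preim -ge.
Qed.

Lemma center_preim0 i : 0 \in center_preim i U.
Proof.
rewrite mem_center_preim -(mulg1 (extraspec_elt _ _)) -(mulgV (extraspec_elt i0 (Heis 0 0 0))).
by rewrite mulgA -central_eltD addr0 mulgV group1.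
Qed.

Lemma center_preimD i :
  {in center_preim i U &, forall c c', c + c' \in center_preim i U}.
Proof. by move=> c c'; rewrite !mem_center_preim central_eltD; apply: groupM. Qed.

Let nUE : E \subset 'N(U).
Proof. by apply: cents_norm; rewrite centsC (subset_trans UZ) ?subsetIr. Qed.

Lemma quotient_cover : magma_cover (@hmul F m) (E / U)%g (coset U \o extraspec_elt i0).
Proof.
split=> [t|x|s t]; first by rewrite mem_quotient ?mem_extraspec_elt.
  by case/morphimP=> g _ /extraspec_eltP-/(_ i0)[t ->] ->; exists t.
by rewrite /= extraspec_eltM morphM // (subsetP nUE) ?mem_extraspec_elt.
Qed.

(** Together with [quotient_cover], this describes the quotient by a central
    subgroup by the same multiplication with a coarser last coordinate. *)
Lemma quotient_eq i s t :
  (coset U \o extraspec_elt i0) s = (coset U \o extraspec_elt i0) t <->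
  s.1 = t.1 /\ s.2 - t.2 \in center_preim i U.
Proof.
have Ns r : extraspec_elt i0 r \in 'N(U) by rewrite (subsetP nUE) ?mem_extraspec_elt.
have eqE c r : (extraspec_elt i0 (Heis 0 0 c) * extraspec_elt i0 r)%g =
      extraspec_elt i0 (Heis r.1.1 r.1.2 (c + r.2)).
  by rewrite -extraspec_eltM hmul_center.
rewrite mem_center_preim; split=> [/(rcoset_kercosetP (Ns s) (Ns t))/rcosetP[u Uu e]|].
  have [c uE] := central_eltP (subsetP UZ u Uu).
  move: e Uu; rewrite uE eqE => /extraspec_elt_inj-> /=; rewrite addrK.
  by split=> //; case: (t.1).
case=> e1 Uc; apply/(rcoset_kercosetP (Ns s) (Ns t))/rcosetP.
by exists (extraspec_elt i0 (Heis 0 0 (s.2 - t.2))); rewrite // eqE subrK -e1 Heis_eta.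
Qed.

End CentralQuotient.

(** * Quotients by subfield hyperplanes *)

Section QuotientIsog.
Local Open Scope ring_scope.
Variables (F F0 : finFieldType) (m k : nat).

Lemma dot_mxvec (M N : 'M[F0]_(m, k)) :
  dot (mxvec M) (mxvec N) = \sum_i dot (row i M) (row i N).
Proof.
rewrite /dot pair_bigA (reindex _ (curry_mxvec_bij _ _)) /=.
by apply: eq_bigr => [[i j]] _; rewrite !mxvecE !mxE.
Qed.

Lemma inj_surj (T T' : finType) (f : T -> T') (y : T') :
  injective f -> #|T| = #|T'| -> exists x, y = f x.
Proof.
move=> f_inj oT; suff /codomP[x ->] : y \in codom f by exists x.
by apply: inj_card_onto; rewrite ?oT.
Qed.

Variables (A B : F -> 'rV[F0]_k) (l : F -> F0).
Hypotheses (AD : {morph A : x y / x + y}) (BD : {morph B : x y / x + y}).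
Hypotheses (lD : {morph l : x y / x + y}) (lAB : forall x y, l (x * y) = dot (A x) (B y)).
Hypotheses (A_inj : injective A) (B_inj : injective B).
Hypotheses (l_surj : forall c, exists x, l x = c) (oF : #|F| = (#|F0| ^ k)%N).
Variables (i0 : 'I_m) (j0 : 'I_(m * k)) (U : {group extraspec_type F m}).
Hypotheses (UZ : U \subset 'Z(extraspec F m)).
Hypothesis lU : forall x, l x = 0 <-> x \in center_preim i0 U.

(** The m x k array of the coordinates of m elements of F, listed as a row. *)
Definition vec_map (C : F -> 'rV[F0]_k) (x : 'rV[F]_m) : 'rV[F0]_(m * k) :=
  mxvec (\matrix_(i, j) C (x 0 i) 0 j).

Lemma row_vec_map (C : F -> 'rV[F0]_k) (x : 'rV[F]_m) i :
  row i (\matrix_(i', j) C (x 0 i') 0 j) = C (x 0 i).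
Proof. by apply/rowP=> j; rewrite !mxE. Qed.

Lemma vec_mapD C : {morph C : x y / x + y} -> {morph vec_map C : x y / x + y}.
Proof.
move=> CD x y; rewrite /vec_map -linearD; congr mxvec.
by apply/matrixP=> i j; rewrite !mxE CD mxE.
Qed.

Lemma vec_map_inj C : injective C -> injective (vec_map C).
Proof.
move=> C_inj x y /(can_inj mxvecK) xy; apply/rowP=> i; apply: C_inj.
by rewrite -!(row_vec_map C) xy.
Qed.

Lemma vec_map_surj C y : injective C -> exists x, y = vec_map C x.
Proof.
move/vec_map_inj/inj_surj; apply.
by rewrite !card_mx oF -expnM !mul1n mulnC.
Qed.

Definition heis_map (t : heis F m) : heis F0 (m * k) :=
  Heis (vec_map A t.1.1) (vec_map B t.1.2) (l t.2).

Lemma l_sum (f : 'I_m -> F) : l (\sum_i f i) = \sum_i l (f i).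
Proof.
by apply: big_morph => //; apply: (addrI (l 0)); rewrite -lD !addr0.
Qed.

Lemma heis_mapM s t : heis_map (hmul s t) = hmul (heis_map s) (heis_map t).
Proof.
rewrite /heis_map /hmul /= !vec_mapD // !lD; congr (Heis _ _ (_ + _)).
rewrite /vec_map dot_mxvec l_sum; apply: eq_bigr => i _.
by rewrite lAB !row_vec_map.
Qed.

(** Applying A, B and l to the coordinates carries the multiplication of F to
    that of F0, and identifies z and z' exactly when they agree modulo the
    hyperplane. *)
Lemma pairing_quotient_isog :
  (extraspec F m / U)%g \isog extraspec F0 (m * k).
Proof.
have [eE Ee eM] := extraspec_cover F0 j0.
apply: (isog_of_covers (quotient_cover i0 UZ)
  (g := fun t => extraspec_elt j0 (heis_map t)) (op := @hmul F m)).
  split=> [t|g|s t]; rewrite ?eE // ?heis_mapM ?eM //.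
  case/Ee=> [[[x y] z] ->].
  have [x' ->] := vec_map_surj x A_inj; have [y' ->] := vec_map_surj y B_inj.
  by have [z' <-] := l_surj z; exists (Heis x' y' z').
move=> s t; apply: (iff_trans (quotient_eq i0 UZ i0 s t)).
have lB x y : l x = l y <-> x - y \in center_preim i0 U.
  have -> : l x = l (x - y) + l y by rewrite -lD subrK.
  rewrite -lU; split=> [|->]; last by rewrite add0r.
  by rewrite -{2}[l y]add0r => /addIr.
split=> [[e1 /lB e2]|/extraspec_elt_inj[/(vec_map_inj A_inj) ex /(vec_map_inj B_inj) ey /lB ez]].
  by rewrite /heis_map e1 e2.
by split=> //; case: (s) (t) ex ey => [[x y] z] [[x' y'] z'] /= -> ->.
Qed.

End QuotientIsog.

Lemma subfield_hyperplane_isog (p n d m : nat) (F F0 : finFieldType)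
    (p_pr : prime p) (oF : #|F| = p ^ n) (oF0 : #|F0| = p ^ d)
    (ch : p \in [pchar F]%R) (i : 'I_m) (U : {group extraspec_type F m}) :
  (0 < n) -> d %| n -> U \subset 'Z(extraspec F m) ->
  subfield_hyperplane ch d (center_preim i U) ->
  (extraspec F m / U)%g \isog extraspec F0 (m * (n %/ d)).
Proof.
move=> n_gt0 dn UZ.
have m_gt0 : 0 < m := leq_ltn_trans (leq0n i) (ltn_ord i).
have d_gt0 : 0 < d := dvdn_gt0 n_gt0 dn.
have k_gt0 : 0 < m * (n %/ d).
  by rewrite muln_gt0 m_gt0 divn_gt0 //; apply: dvdn_leq.
case/(subfield_hyperplane_pairing p_pr oF oF0 dn)=> [A [B [l [[AD BD lD]]]]].
case=> [Ai Bi ls lU lAB].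
apply: (pairing_quotient_isog AD BD lD lAB Ai Bi ls _ (Ordinal k_gt0) UZ lU).
by rewrite oF oF0 -expnM mulnC divnK.
Qed.

(** * Recovering the subfield from an isomorphism *)

Section Centroid.
Local Open Scope ring_scope.
Variables (F F0 : finFieldType) (m m0 : nat) (i : 'I_m).
Local Notation V2 := ('rV[F]_m * 'rV[F]_m)%type.
Local Notation V20 := ('rV[F0]_m0 * 'rV[F0]_m0)%type.
Variables (V : {set F}) (tau : V2 -> V20).
Hypotheses (V_proper : exists t, t \notin V).
Hypothesis tauD : {morph tau : v w / v + w}.
Hypothesis tau_surj : forall u, exists v, tau v = u.
Hypothesis tau_symp : forall v w : V2, symp v w \in V <-> symp (tau v) (tau w) = 0.

Implicit Types (v w : V2) (c : F0).

(** The values on the F-line of w form an F-subspace of F, which is all of F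
    unless it vanishes. *)
Lemma symp_in_hyperplane v w : (forall a, symp v (a *: w) \in V) -> symp v w = 0.
Proof.
move=> vwV; apply/eqP; apply/idPn=> vw0; have [t /negP[]] := V_proper.
by have := vwV (t / symp v w); rewrite sympZr divfK.
Qed.

Lemma tau0 : tau 0 = 0.
Proof. by apply: (addrI (tau 0)); rewrite -tauD !addr0. Qed.

Lemma tau_inj : injective tau.
Proof.
have ker v : tau v = 0 -> v = 0.
  move=> v0; apply: symp_nondegenerate=> w; apply: symp_in_hyperplane => a.
  by apply/tau_symp; rewrite v0 symp0l.
move=> v w vw; apply/eqP; rewrite -subr_eq0; apply/eqP/ker/(addIr (tau w)).
by rewrite -tauD subrK add0r.
Qed.

(** For c in F0 the map al c := tau^-1 (c * tau _) preserves the relation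
    of being orthogonal modulo V, hence, applied to all multiples of a vector,
    orthogonality over F. So it fixes every line and is a scalar f c. Evaluating
    at two vectors with pairing u shows that f c * u is in V. *)
Lemma centroid_embedding :
  exists f : {rmorphism F0 -> F}, forall c, {in V, forall u, f c * u \in V}.
Proof.
have /fin_all_exists[sig tauK] := tau_surj.
have sigK v : sig (tau v) = v by apply: tau_inj; rewrite tauK.
have sigD : {morph sig : v w / v + w}.
  by move=> v w; apply: tau_inj; rewrite tauD !tauK.
have V0 : 0 \in V.
  by rewrite -(symp0l (0 : V2)); apply/tau_symp; rewrite tau0 symp0l.
pose al c v := sig (c *: tau v).
have symp_al c v w : symp v w \in V -> symp (al c v) w \in V.
  by move/tau_symp=> vw; apply/tau_symp; rewrite tauK sympZl vw mulr0.
have al_line c v : exists a, al c v = a *: v.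
  apply: symp_line => w vw; apply: symp_in_hyperplane => a; apply: symp_al.
  by rewrite sympZr vw mulr0.
have /fin_all_exists[f fP] c : exists a, forall v, al c v = a *: v.
  apply: (additive_lines_scalar i) (al_line c) => v w.
  by rewrite /al tauD scalerDr sigD.
pose e : V2 := (delta_mx 0 i, 0).
have f_uniq a b : a *: e = b *: e -> a = b.
  by case=> /rowP/(_ i); rewrite !mxE !eqxx !mulr1.
have fB : zmod_morphism f.
  move=> c d; apply: f_uniq; rewrite scalerBl -!fP.
  by apply: (addIr (al d e)); rewrite subrK -sigD -scalerDl subrK.
have fM : monoid_morphism f.
  split=> [|c d]; apply: f_uniq; first by rewrite -fP /al !scale1r sigK.
  by rewrite -scalerA -!fP /al tauK scalerA.
pose fa := GRing.isZmodMorphism.Build _ _ f fB.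
pose fm := GRing.isMonoidMorphism.Build _ _ f fM.
pose fr : {rmorphism F0 -> F} := HB.pack f fa fm.
exists fr => c u Vu.
have e_symp a : symp (a *: e) (0, delta_mx 0 i) = a.
  by rewrite sympZl /symp /= dot_delta mxE !eqxx dot0l subr0 mulr1.
by rewrite -[_ * u]e_symp -scalerA -fP symp_al // e_symp.
Qed.

End Centroid.

Section HyperplaneOfIsog.
Local Open Scope ring_scope.
Variables (F F0 : finFieldType) (m m0 : nat) (i : 'I_m) (j : 'I_m0).
Variable U : {group extraspec_type F m}.
Hypothesis UpZ : U \proper 'Z(extraspec F m).
Hypothesis isoE : (extraspec F m / U)%g \isog extraspec F0 m0.
Local Notation V := (center_preim i U).
Implicit Types (s t : heis F m).

Let UZ : U \subset 'Z(extraspec F m) := proper_sub UpZ.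

Lemma hmul_comm (E : finFieldType) k (s t : heis E k) :
  hmul s t = hmul t s <-> symp s.1 t.1 = 0.
Proof.
rewrite /hmul [t.1.1 + _]addrC [t.1.2 + _]addrC [t.2 + s.2]addrC.
split=> [/(congr1 snd)/= /addrI e|]; first by rewrite /symp e subrr.
by move/eqP; rewrite subr_eq0 => /eqP->.
Qed.

(** An isomorphism lifted to the coordinates. The lift is multiplicative
    because coordinates in the target group are unique. *)
Lemma heis_isog_map : exists th : heis F m -> heis F0 m0,
  [/\ {morph th : s t / hmul s t >-> hmul s t}, forall u, exists t, th t = u &
      forall s t, th s = th t <-> s.1 = t.1 /\ s.2 - t.2 \in V].
Proof.
have [qE Eq qM] := quotient_cover i UZ; have [eE Ee eM] := extraspec_cover F0 j.
have /isogP[g inj_g gE] := isoE.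
have th_ex (t : 'rV[F]_m * 'rV[F]_m * F) : exists u : 'rV[F0]_m0 * 'rV[F0]_m0 * F0,
    g ((coset U \o extraspec_elt i) t) = extraspec_elt j u.
  by apply: Ee; rewrite -gE mem_morphim ?qE.
have [th thE] := fin_all_exists th_ex; exists th; split.
- by move=> s t; apply: (@extraspec_elt_inj _ _ j); rewrite eM -!thE qM morphM ?qE.
- move=> u; have := eE u; rewrite -gE => /morphimP[x _ /Eq[t ->] ue].
  by exists t; apply: (@extraspec_elt_inj _ _ j); rewrite -thE.
move=> s t; apply: iff_trans (quotient_eq i UZ i s t).
split=> [st|st].
  by apply: (injmP inj_g); rewrite ?qE // !thE st.
by apply: (@extraspec_elt_inj _ _ j); rewrite -!thE st.
Qed.

Lemma center_preim_proper : exists t : F, t \notin V.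
Proof.
have [_ [g Zg Ug]] := properP UpZ; have [c ge] := central_eltP i Zg.
by exists c; rewrite (mem_center_preim i) -ge.
Qed.

(** The first two coordinates tau of the lifted isomorphism depend only on the
    first two coordinates, since central elements go to central elements; and
    commuting elements correspond to commuting elements. *)
Lemma hyperplane_embedding :
  exists f : {rmorphism F0 -> F}, forall c, {in V, forall u, f c * u \in V}.
Proof.
have [th [thM th_surj th_eq]] := heis_isog_map.
pose tau (v : 'rV[F]_m * 'rV[F]_m) := (th (Heis v.1 v.2 0)).1.
have th_symp s t : symp s.1 t.1 \in V <-> symp (th s).1 (th t).1 = 0.
  have e1 : (hmul s t).1 = (hmul t s).1.
    by rewrite /= [s.1.1 + _]addrC [s.1.2 + _]addrC.
  have e2 : (hmul s t).2 - (hmul t s).2 = symp s.1 t.1.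
    by rewrite /symp /=; ring.
  by rewrite -hmul_comm -!thM th_eq e2; split=> [|[]].
have th_center z : (th (Heis 0 0 z)).1 = 0.
  apply: symp_nondegenerate => w; have [t tw] := th_surj (Heis w.1 w.2 0).
  have -> : w = (th t).1 by rewrite tw; case: (w).
  by apply/th_symp; rewrite symp0l (center_preim0 i).
have tauE t : (th t).1 = tau t.1.
  have {1}-> : t = hmul (Heis t.1.1 t.1.2 0) (Heis 0 0 t.2).
    by rewrite /hmul /= dot0r !addr0 add0r; case: (t) => [[]].
  rewrite thM /tau -[RHS]addr0 -(th_center t.2).
  by case: (th _) (th _) => [[? ?] ?] [[? ?] ?].
apply: (@centroid_embedding F F0 m m0 i V tau) => [|v w|u|v w].
- exact: center_preim_proper.
- have := thM (Heis v.1 v.2 0) (Heis w.1 w.2 0) => /(congr1 fst).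
  by rewrite tauE /= => ->.
- by have [t tu] := th_surj (Heis u.1 u.2 0); exists t.1; rewrite -tauE tu; case: (u).
by have := th_symp (Heis v.1 v.2 0) (Heis w.1 w.2 0); rewrite !tauE /=; case: v w => [? ?] [? ?].
Qed.

(** Compares the orders of the two isomorphic groups; the factors q ^ 2m
    cancel. *)
Lemma card_center_preim_isog k :
  #|F| = (#|F0| ^ k)%N -> m0 = (m * k)%N -> (#|V| * #|F0| = #|F|)%N.
Proof.
move=> oF m0E; rewrite (card_center_preim i UZ).
have nUE : extraspec F m \subset 'N(U).
  by apply: cents_norm; rewrite centsC (subset_trans UZ) ?subsetIr.
have := Lagrange (subset_trans UZ (center_sub _)).
rewrite -card_quotient // (card_isog isoE) !card_extraspec //.
have -> : (m0 + m0)%N = (k * (m + m))%N by rewrite m0E mulnDr ![(k * _)%N]mulnC.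
rewrite 2!expnS expnM -oF mulnA [(#|F| * _)%N]mulnC [(_ * _ ^ _)%N]mulnC.
have q_gt0 : (0 < #|F| ^ (m + m))%N by rewrite expn_gt0 (ltnW (finNzRing_gt1 F)).
by move/eqP; rewrite eqn_pmul2l // => /eqP.
Qed.

End HyperplaneOfIsog.

Lemma isog_subfield_hyperplane (p n d m : nat) (F F0 : finFieldType)
    (p_pr : prime p) (oF : #|F| = p ^ n) (oF0 : #|F0| = p ^ d)
    (ch : p \in [pchar F]%R) (i : 'I_m) (U : {group extraspec_type F m}) :
  (0 < n) -> d %| n -> U \proper 'Z(extraspec F m) ->
  (extraspec F m / U)%g \isog extraspec F0 (m * (n %/ d)) ->
  subfield_hyperplane ch d (center_preim i U).
Proof.
move=> n_gt0 dn UpZ isoE; have UZ := proper_sub UpZ.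
have m_gt0 : 0 < m := leq_ltn_trans (leq0n i) (ltn_ord i).
have d_gt0 : 0 < d := dvdn_gt0 n_gt0 dn.
have k_gt0 : 0 < m * (n %/ d).
  by rewrite muln_gt0 m_gt0 divn_gt0 //; apply: dvdn_leq.
pose j := Ordinal k_gt0.
have [f fV] := hyperplane_embedding i j UpZ isoE.
apply: (@subfield_hyperplane_intro F p n d F0 p_pr oF oF0 ch f).
- exact: center_preim0 i _ _.
- exact: center_preimD i _ _.
- exact: fV.
rewrite -oF0 -oF; apply: (card_center_preim_isog i j UpZ isoE _ (erefl _)).
by rewrite oF oF0 -expnM mulnC divnK.
Qed.

(** Every additive subgroup is stable under the prime field, so this is the
    case d = 1. *)
Lemma central_hyperplane_isog (p n m : nat) (F : finFieldType)
    (p_pr : prime p) (oF : #|F| = p ^ n) (U : {group extraspec_type F m}) :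
  0 < n -> 0 < m -> U \subset 'Z(extraspec F m) -> #|U| = p ^ n.-1 ->
  (extraspec F m / U)%g \isog extraspec 'F_p (m * n).
Proof.
move=> n_gt0 m_gt0 UZ oU; pose i := Ordinal m_gt0.
have oFp : #|'F_p| = p ^ 1 by rewrite card_Fp // expn1.
have [f _] := finField_embed p_pr (dvd1n n) oFp oF.
have := subfield_hyperplane_isog p_pr oF oFp (ch := card_finPcharP oF p_pr) (i := i)
  n_gt0 (dvd1n n) UZ.
rewrite divn1; apply.
have VD := center_preimD i (U := U) (i := i).
apply: (@subfield_hyperplane_intro F p n 1 _ p_pr oF oFp _ f) => //.
- exact: center_preim0 i _ _.
- move=> c v Vv; rewrite -[c]natr_Zp rmorph_nat mulr_natl.
  by elim: (c : nat) => [|k IH]; rewrite ?mulr0n ?(center_preim0 i) // mulrS VD.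
by rewrite (card_center_preim i UZ) oU expn1 mulnC -expnS prednK.
Qed.

(** * Sylow subgroups of SL(3, q) *)

Section SylowLinear.
Variables (F : finFieldType) (p n : nat).
Hypotheses (p_pr : prime p) (n_gt0 : 0 < n) (oF : #|F| = p ^ n).

Lemma card_unitri3 : #|unitri3 F| = (#|F| ^ 3)%N.
Proof.
have -> : unitri3 F = [set u3 t.1.1 t.1.2 t.2 | t in [set: F * F * F]].
  apply/setP=> g; apply/idP/imsetP=> [/unitri3_u3[a [b [c ->]]]|[t _ ->]].
    by exists (a, b, c).
  exact: mem_u3.
rewrite card_imset => [|[[a b] c] [[a' b'] c'] /u3_inj[/= -> -> ->] //].
by rewrite cardsT !card_prod !expnS expn0 muln1 mulnA.
Qed.

(** The index of the unitriangular group in GL(3, F) is a product of numbers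
    q ^ i - 1, prime to p. *)
Lemma unitri3_Sylow_GL : p.-Sylow([set: {'GL_3[F]}]) (unitri3 F).
Proof.
have p_q i : 0 < i -> p %| #|F| ^ i.
  by move=> i_gt0; rewrite oF dvdn_exp // dvdn_exp.
have p'q i : 0 < i -> p^'.-nat (#|F| ^ i - 1).
  move=> i_gt0; rewrite p'natE //; apply: contraL (prime_gt1 p_pr) => pq1.
  have := dvdn_sub (p_q i i_gt0) pq1; rewrite subKn; last first.
    by rewrite expn_gt0 (ltnW (finNzRing_gt1 F)).
  by rewrite dvdn1 => /eqP->.
apply/and3P; split; first exact: subsetT.
  by rewrite /pgroup card_unitri3 oF pnatX pnatX pnat_id.
rewrite -divgS ?subsetT //= card_unitri3 card_GL // mulKn; last first.
  by rewrite expn_gt0 (ltnW (finNzRing_gt1 F)).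
by rewrite unlock /= !pnatM !p'q.
Qed.

Lemma unitri3_sub_SL : unitri3 F \subset SL F 3.
Proof.
apply/subsetP=> _ /unitri3_u3[a [b [c ->]]]; rewrite inE -det_tr det_trig.
  by rewrite big1 // => i _; rewrite !mxE eqxx.
apply/is_trig_mxP=> i j; rewrite !mxE.
by move: j i; do 2!apply: ord3P.
Qed.

Lemma Sylow_SL3_isog (P : {group {'GL_3[F]}}) :
  p.-Sylow(SL F 3) P -> unitri3 F \isog P.
Proof.
move=> sylP; have sylU : p.-Sylow(SL F 3) (unitri3 F).
  exact: pHall_subl unitri3_sub_SL (subsetT _) unitri3_Sylow_GL.
by have [x _ ->] := Sylow_trans sylU sylP; apply: conj_isog.
Qed.

End SylowLinear.

(** * Sylow subgroups of SU(3, q) *)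

Section HermitianForm.
Local Open Scope ring_scope.
Variables (E : finFieldType) (bar : {rmorphism E -> E}).
Local Notation o0 := (ord0 : 'I_3).
Local Notation o1 := (lift ord0 ord0 : 'I_3).
Local Notation o2 := (ord_max : 'I_3).

(** The Gram matrix of the Hermitian form for which the upper unitriangular
    group contains a Sylow subgroup of the isometry group. *)
Definition anti_mx : 'M[E]_3 := \matrix_(i, j) (i + j == 2)%N%:R.

Lemma anti_mx_entry (h : 'M[E]_3) i j :
  (h *m anti_mx *m (map_mx bar h)^T) i j =
  h i o0 * bar (h j o2) + h i o1 * bar (h j o1) + h i o2 * bar (h j o0).
Proof.
rewrite !mxE sum3 !mxE !sum3 !mxE /=.
by rewrite !mulr0 !mulr1 !addr0 !add0r; ring.
Qed.

Definition SU_anti : {set {'GL_3[E]}} :=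
  [set g in SL E 3 | GLval g *m anti_mx *m (map_mx bar (GLval g))^T == anti_mx].

Lemma SU_anti_group_set : group_set SU_anti.
Proof.
apply/group_setP; split=> [|g h].
  by rewrite !inE GL_1E det1 map_mx1 trmx1 mul1mx mulmx1 !eqxx.
rewrite !inE => /andP[Sg /eqP Jg] /andP[Sh /eqP Jh].
rewrite GL_MxE det_mulmx (eqP Sg) (eqP Sh) mulr1 eqxx /=.
by apply/eqP; rewrite map_mxM trmx_mul -[RHS]Jg -[in RHS]Jh !mulmxA.
Qed.

Canonical SU_anti_group := Group SU_anti_group_set.

Lemma SU_anti_entry g i j : g \in SU_anti ->
  GLval g i o0 * bar (GLval g j o2) + GLval g i o1 * bar (GLval g j o1)
    + GLval g i o2 * bar (GLval g j o0) = (i + j == 2)%N%:R.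
Proof.
by rewrite inE => /andP[_ /eqP/matrixP/(_ i j)]; rewrite anti_mx_entry mxE.
Qed.

Hypothesis barK : forall x, bar (bar x) = x.

Lemma u3_SU_anti a c b :
  u3 a c b \in SU_anti <-> c = - bar a /\ b + bar b = - (a * bar a).
Proof.
split=> [gJ|[-> bb]].
  have := SU_anti_entry o0 o0 gJ; have := SU_anti_entry o1 o0 gJ.
  rewrite !mxE /= !rmorph0 !rmorph1 !mul1r !mulr1 !mul0r add0r => e1 e2.
  split; first by rewrite -[RHS]addr0 -e1 addKr.
  by apply: (addIr (a * bar a)); rewrite addNr -[RHS]e2; ring.
rewrite inE (subsetP (unitri3_sub_SL E)) ?mem_u3 //=; apply/eqP/matrixP=> i j.
rewrite anti_mx_entry; move: i j; have bb' := canRL (addKr _) bb.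
do 2!apply: ord3P; rewrite !mxE /= ?rmorph0 ?rmorph1 ?rmorphN ?barK ?bb'; ring.
Qed.

Variable p n : nat.
Hypotheses (p_pr : prime p) (n_gt0 : (0 < n)%N) (oE : #|E| = (p ^ n)%N).

Lemma row3_mul (v : 'rV[E]_3) (A : 'M[E]_3) j :
  (v *m A) 0 j = v 0 o0 * A o0 j + v 0 o1 * A o1 j + v 0 o2 * A o2 j.
Proof. by rewrite mxE sum3. Qed.

(** A Sylow p-subgroup R of the special isometry group is conjugate in GL(3, E)
    into the unitriangular group, hence fixes a nonzero row v. If R contains the
    unitriangular isometries, v is proportional to the last basis row. Fixing
    this isotropic row, preserving the form and having determinant 1 forces a
    matrix to be unitriangular. *)
Lemma unitri3_SU_anti_Sylow a b : a != 0 -> b + bar b = - (a * bar a) ->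
  p.-Sylow(SU_anti) (unitri3 E :&: SU_anti).
Proof.
move=> a0 ab; have uJ : u3 a (- bar a) b \in SU_anti by apply/u3_SU_anti.
have sylU := unitri3_Sylow_GL p_pr n_gt0 oE.
have pU : p.-group (unitri3 E :&: SU_anti) := pgroupS (subsetIl _ _) (pHall_pgroup sylU).
have [R sylR UR] := Sylow_superset (subsetIr _ _) pU.
suff RU : R \subset unitri3 E by rewrite (_ : _ :&: _ = R) //; apply/eqP;
  rewrite eqEsubset UR subsetI RU (pHall_sub sylR).
have [x _ Rx] := Sylow_Jsub sylU (subsetT R) (pHall_pgroup sylR).
pose v : 'rV[E]_3 := delta_mx 0 o2 *m GLval x^-1.
have vR r : r \in R -> v *m GLval r = v.
  move=> Rr; have /unitri3_u3[a' [c' [b' e]]] : (r ^ x)%g \in unitri3 E.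
    by rewrite (subsetP Rx) ?memJ_conjg.
  have xr : (x^-1 * r = u3 a' c' b' * x^-1)%g by rewrite -e conjgE mulgA mulgK.
  have {}xr : GLval x^-1 *m GLval r = GLval (u3 a' c' b') *m GLval x^-1.
    exact: (congr1 (fun g : {'GL_3[E]} => GLval g) xr).
  rewrite /v -mulmxA xr mulmxA; congr (_ *m _).
  by apply/rowP; apply: ord3P; rewrite row3_mul !mxE /= ; ring.
have v0 : v != 0.
  apply/eqP=> v0; have : v *m GLval x = delta_mx 0 o2.
    have xx : GLval x^-1 *m GLval x = 1%:M  := congr1 (fun g : {'GL_3[E]} => GLval g) (mulVg x).
    by rewrite /v -mulmxA xx mulmx1.
  by rewrite v0 mul0mx => /rowP/(_ o2); rewrite !mxE => /eqP; rewrite eq_sym oner_eq0.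
clearbody v.
(* As a != 0, this isometry fixes only multiples of the last basis row. *)
have vu := vR _ (subsetP UR _ (introT setIP (conj (mem_u3 _ _ _) uJ))).
have v00 : v 0 o0 = 0.
  move/rowP/(_ o1): vu; rewrite row3_mul !mxE /= mulr1 mulr0 addr0.
  by move/(canRL (addrK _)); rewrite subrr => /eqP; rewrite mulf_eq0 (negPf a0) orbF => /eqP.
have v01 : v 0 o1 = 0.
  move/rowP/(_ o2): vu; rewrite row3_mul !mxE /= mulr1 v00 mul0r add0r. 
  move/(canRL (addrK _)); rewrite subrr => /eqP.
  by rewrite mulf_eq0 oppr_eq0 fmorph_eq0 (negPf a0) orbF => /eqP.
have v02 : v 0 o2 != 0.
  by apply: contraNneq v0 => v02; apply/eqP/rowP; apply: ord3P; rewrite ?v00 ?v01 ?v02 mxE.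
apply/subsetP=> r Rr; have rJ := subsetP (pHall_sub sylR) r Rr.
have r2 j : GLval r o2 j = (j == o2)%:R.
  have /rowP/(_ j) := vR r Rr; rewrite row3_mul v00 v01 !mul0r !add0r => e.
  apply: (mulfI v02); rewrite e; move: j e; apply: ord3P; rewrite ?v00 ?v01 ?mulr0 ?mulr1 //.
(* r fixes the last row; the form then controls the first column. *)
have r00 : GLval r o0 o0 = 1.
  have := SU_anti_entry o0 o2 rJ; rewrite !r2 /= !rmorph0 rmorph1 mulr1 !mulr0 !addr0.
  by [].
have r10 : GLval r o1 o0 = 0.
  have := SU_anti_entry o1 o2 rJ; rewrite !r2 /= !rmorph0 rmorph1 mulr1 !mulr0 !addr0.
  by [].
have r_trig : is_trig_mx (GLval r)^T.
  apply/is_trig_mxP=> i j; rewrite mxE; move: i j.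
  by do 2!apply: ord3P => //; rewrite ?r2 ?r10.
have r11 : GLval r o1 o1 = 1.
  move: rJ; rewrite !inE -det_tr det_trig // => /andP[/eqP + _].
  rewrite !big_ord_recl big_ord0 !mxE r00 mul1r mulr1 (_ : lift _ (lift _ _) = o2).
    by rewrite r2 mulr1.
  exact: val_inj.
apply/unitri3P; do 2!apply: ord3P; rewrite ?r2 ?r10 ?r00 ?r11 //.
Qed.

End HermitianForm.

Section SpecialUnitary.
Local Open Scope ring_scope.
Variables (F E : finFieldType) (p n : nat).
Hypotheses (p_pr : prime p) (p_odd : odd p) (n_gt0 : (0 < n)%N).
Hypotheses (oF : #|F| = (p ^ n)%N) (oE : #|E| = ((p ^ n) ^ 2)%N).
Local Notation q := (p ^ n)%N.

Let oE2 : #|E| = (p ^ (n * 2))%N. Proof. by rewrite oE expnM. Qed.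

Definition qbar (x : E) : E := x ^+ q.

Fact qbar_zmod_morphism : zmod_morphism qbar.
Proof.
have pE := card_finPcharP oE2 p_pr; have pq : [pchar E].-nat q.
  by rewrite pnatX (eq_pnat _ (pcharf_eq pE)) pnat_id.
move=> x y; apply: (addIr (qbar y)); rewrite subrK /qbar.
by rewrite -exprDn_pchar // subrK.
Qed.

Fact qbar_monoid_morphism : monoid_morphism qbar.
Proof. by split=> [|x y]; rewrite /qbar ?expr1n // exprMn. Qed.

HB.instance Definition _ := GRing.isZmodMorphism.Build E E qbar qbar_zmod_morphism.
HB.instance Definition _ := GRing.isMonoidMorphism.Build E E qbar qbar_monoid_morphism.

Local Notation bar := (qbar : {rmorphism E -> E}).

Lemma qbarK x : bar (bar x) = x.
Proof. by rewrite /= /qbar -exprM mulnn -oE expf_card. Qed.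

(** Suitable powers of a primitive root of E: d spans the skew elements over F,
    and b has norm -1. *)
Lemma qbar_roots : exists d b : E, [/\ d != 0, bar d = - d & b * bar b = -1].
Proof.
have [g [g_ord g0] [_ g_dvd]] := finField_generator E.
have q_odd : odd q by rewrite oddX p_odd orbT.
have q_gt1 : (1 < q)%N by rewrite -oF finNzRing_gt1.
pose r := q./2; have qE : q = r.*2.+1.
  by rewrite -[LHS]odd_double_half q_odd.
have r_gt0 : (0 < r)%N by case: r qE q_gt1 => [->|].
(* With q = 2 r + 1, the order of g is q ^ 2 - 1 = 4 r (r + 1). *)
have E1 : (#|E|.-1 = (r * r.+1).*2.*2)%N.
  by rewrite oE qE -!mul2n; apply: (canLR (@succnK)); ring.
pose s := g ^+ (r * r.+1).*2.
have s2 : s ^+ 2 = 1 by rewrite -exprM muln2 -E1.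
have s1 : s != 1.
  have s_gt0 : (0 < (r * r.+1).*2)%N by rewrite double_gt0 muln_gt0 r_gt0.
  apply/eqP=> /g_dvd; rewrite E1 => /(dvdn_leq s_gt0); apply/negP.
  by rewrite -ltnNge -[X in (_ < X)%N]addnn -[X in (X < _)%N]addn0 ltn_add2l.
have sN1 : s = -1.
  by have := s2; move/eqP; rewrite sqrf_eq1 (negPf s1) => /eqP.
exists (g ^+ r.+1), (g ^+ r); split.
- by rewrite expf_neq0.
- rewrite /= /qbar -exprM -mulN1r -sN1 -exprD qE; congr (_ ^+ _).
  by rewrite -!mul2n; ring.
rewrite /= /qbar -exprM -exprD -sN1 qE; congr (_ ^+ _).
by rewrite -!mul2n; ring.
Qed.

(** X^q - X already has q roots in the image of F. *)
Lemma qbar_fixed (f : {rmorphism F -> E}) x : bar x = x -> exists c, x = f c.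
Proof.
move=> xq; have : map_poly f ('X^#|F| - 'X) = \prod_(c : F) ('X - (f c)%:P).
  rewrite finField_genPoly rmorph_prod; apply: eq_bigr => c _.
  by rewrite rmorphB /= map_polyX map_polyC.
move/(congr1 (horner^~ x)); rewrite rmorphB /= map_polyXn map_polyX.
rewrite !hornerE oF [x ^+ _]xq subrr horner_prod => /esym/eqP.
by rewrite prodf_seq_eq0 => /hasP[c _]; rewrite /= !hornerE subr_eq0 => /eqP->; exists c.
Qed.

Lemma qbar_f (f : {rmorphism F -> E}) c : bar (f c) = f c.
Proof. by rewrite /= /qbar -oF -rmorphXn /= expf_card. Qed.

(** Writing the (1, 2) entry as x + d y with x and y in F, the form
    determines the (1, 3) entry up to its skew part d t. Products add t up to
    the commutator pairing, and t = 2 z - x y turns this cocycle into x y'. *)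
Lemma SU_anti_unitri3_cover (d : E) : d != 0 -> bar d = - d ->
  exists2 phi, magma_cover (@hmul F 1) (unitri3 E :&: SU_anti bar) phi & injective phi.
Proof.
move=> d0 barD.
have [f _] := finField_embed p_pr (dvdn_mulr 2 (dvdnn n)) oF oE2.
have two0 := two_neq0 p_pr p_odd oE2.
pose A (x y : F) : E := f x + d * f y.
pose B (x y z : F) : E := - (A x y * bar (A x y)) / 2%:R + d * f (2%:R * z - x * y).
have barA x y : bar (A x y) = f x - d * f y.
  by rewrite rmorphD rmorphM /= !(qbar_f f) [qbar d]barD mulNr.
pose phi (t : heis F 1) : {'GL_3[E]} := u3 (A (t.1.1 0 0) (t.1.2 0 0))
  (- bar (A (t.1.1 0 0) (t.1.2 0 0))) (B (t.1.1 0 0) (t.1.2 0 0) t.2).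
have two0F : 2%:R != 0 :> F by rewrite -(fmorph_eq0 f) rmorph_nat.
have barB x y z : bar (B x y z) =
    - (A x y * bar (A x y)) / 2%:R - d * f (2%:R * z - x * y).
  rewrite rmorphD !rmorphM /= (qbar_f f) [qbar d]barD mulNr; congr (_ - _).
  by rewrite rmorphN rmorphM fmorphV rmorph_nat /= [qbar (qbar _)]qbarK [_ * qbar _]mulrC.
have A_inj x y x' y' : A x y = A x' y' -> x = x' /\ y = y'.
  move=> e; have e' := congr1 bar e; rewrite !barA in e'.
  have ex : x = x'.
    apply: (fmorph_inj f); apply: (mulfI two0).
    transitivity (A x y + (f x - d * f y)); first by rewrite /A; ring.
    by rewrite e e' /A; ring.
  split=> //; apply: (fmorph_inj f); apply: (mulfI d0).
  by apply: (addrI (f x)); rewrite {2}ex.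
have A_surj a : exists x y, a = A x y.
  have [x xE] : exists x, (a + bar a) / 2%:R = f x.
    apply: qbar_fixed; rewrite rmorphM rmorphD fmorphV rmorph_nat /=.
    by rewrite [qbar (qbar _)]qbarK addrC.
  have [y yE] : exists y, (a - bar a) / (2%:R * d) = f y.
    apply: qbar_fixed; rewrite rmorphM rmorphB fmorphV rmorphM rmorph_nat /=.
    rewrite [qbar (qbar _)]qbarK [qbar d]barD mulrN invrN mulrN -mulNr opprB //.
  exists x, y; rewrite /A -xE -yE; field.
  by rewrite two0 d0.
exists phi; first split=> [t|g|s t].
- rewrite inE mem_u3; apply/(u3_SU_anti qbarK); split=> //.
  by rewrite barB /B; field.
- case/setIP=> /unitri3_u3[a [c [b ->]]] /(u3_SU_anti qbarK)[-> bb].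
  have [x [y aE]] := A_surj a.
  have [t tE] : exists t, (b - bar b) / (2%:R * d) = f t.
    apply: qbar_fixed; rewrite rmorphM rmorphB fmorphV rmorphM rmorph_nat /=.
    by rewrite [qbar (qbar _)]qbarK [qbar d]barD mulrN invrN mulrN -mulNr opprB.
  exists (Heis (const_mx x) (const_mx y) ((t + x * y) / 2%:R)).
  rewrite /phi /= !mxE -aE; congr u3; rewrite /B -aE -bb.
  have -> : 2%:R * ((t + x * y) / 2%:R) - x * y = t by field.
  rewrite -tE; field.
  by rewrite two0 d0.
- rewrite u3M /phi /hmul /= /dot big_ord1 !mxE.
  move: (s.1.1 0 0) (s.1.2 0 0) s.2 (t.1.1 0 0) (t.1.2 0 0) t.2 => x y z x' y' z'.
  have AD : A (x + x') (y + y') = A x y + A x' y'.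
    by rewrite /A !rmorphD; ring.
  rewrite AD rmorphD opprD; congr u3; rewrite /B AD rmorphD !barA /A.
  by rewrite !(rmorphB, rmorphD, rmorphM, rmorph_nat) /=; field.
case=> [[x y] z] [[x' y'] z'] /u3_inj[/= /A_inj[ex ey] _].
have {}ex : x = x' by apply/rowP=> i; rewrite ord1.
have {}ey : y = y' by apply/rowP=> i; rewrite ord1.
rewrite ex ey /B => /addrI/(mulfI d0)/(fmorph_inj f)/addIr/(mulfI two0F)->.
by [].
Qed.

(** Rows e, w, f with e and f isotropic, w of norm 1 and orthogonal to both,
    and (e, f) = 1, for the standard form; e = (1, b, 0) is isotropic as b has
    norm -1. *)
Definition unitary_basis (b : E) : 'M[E]_3 := \matrix_(i, j)
  if i == 0 :> nat then (if j == 0 :> nat then 1 else if j == 1 :> nat then b else 0)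
  else if i == 1 :> nat then (j == 2 :> nat)%:R
  else (if j == 0 :> nat then 2%:R^-1 else if j == 1 :> nat then - b / 2%:R else 0).

Lemma unitary_basisP b : b * bar b = -1 ->
  unitary_basis b *m (map_mx bar (unitary_basis b))^T = anti_mx E.
Proof.
move=> bb; apply/matrixP=> i j; rewrite !mxE sum3 !mxE; move: i j.
have two0 := two_neq0 p_pr p_odd oE2.
have b0 : b != 0.
  apply/eqP=> b0; move: bb; rewrite b0 mul0r => /eqP.
  by rewrite eq_sym oppr_eq0 oner_eq0.
have bbE : bar b = - b^-1 by apply: (mulfI b0); rewrite bb mulrN mulfV.
by do 2!apply: ord3P;
  rewrite /= !(rmorph0, rmorph1, rmorphM, rmorphN, fmorphV, rmorph_nat) /=;
  rewrite ?[qbar b]bbE; field; rewrite ?b0 ?two0.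
Qed.

Lemma SU_group_set : group_set (SU E 3 q).
Proof.
apply/group_setP; split=> [|g h].
  by rewrite !inE GL_1E det1 (map_mx1 bar) trmx1 mulmx1 !eqxx.
rewrite !inE => /andP[Sg /eqP Jg] /andP[Sh /eqP Jh].
rewrite GL_MxE det_mulmx (eqP Sg) (eqP Sh) mulr1 eqxx /=.
have {}Jh : GLval h *m (map_mx bar (GLval h))^T = 1%:M := Jh.
by apply/eqP; rewrite (map_mxM bar) trmx_mul mulmxA -(mulmxA (GLval g)) Jh mulmx1.
Qed.

(** Conjugation by the matrix of the isotropic basis exchanges the isometry
    groups of the standard and antidiagonal forms. *)
Lemma Sylow_SU3_isog (P : {group {'GL_3[E]}}) :
  p.-Sylow(SU E 3 q) P -> unitri3 F \isog P.
Proof.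
move=> sylP; pose S := Group SU_group_set.
have [d [b [d0 barD bb]]] := qbar_roots.
have TJ := unitary_basisP bb; set T := unitary_basis b in TJ.
have T_unit : T \is a GRing.unit.
  have JJ : anti_mx E *m anti_mx E = 1%:M.
    by apply/matrixP; do 2!apply: ord3P; rewrite !mxE sum3 !mxE /=; ring.
  have := mulmx1_unit (etrans (mulmxA _ _ _) (etrans (congr1 (mulmx^~ _) TJ) JJ)).
  by case.
pose x : {'GL_3[E]} := FinRing.Unit T_unit.
have SE : S :=: SU_anti bar :^ x.
  apply/setP=> g; rewrite -[in RHS](conjgKV x g) memJ_conjg !inE.
  have hT : GLval (g ^ x^-1)%g *m T = T *m GLval g.
    have : (g ^ x^-1 * x = x * g)%g by rewrite conjgE invgK !mulgA mulgKV.
    by move=> e; apply: (congr1 (fun g : {'GL_3[E]} => GLval g) e).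
  have -> : \det (GLval (g ^ x^-1)%g) = \det (GLval g).
    apply: (mulIf (x := \det T)); first by rewrite -unitfE -unitmxE.
    by rewrite -det_mulmx hT det_mulmx mulrC.
  congr (_ && _); rewrite -TJ mulmxA hT -mulmxA -trmx_mul -(map_mxM bar) hT.
  rewrite (map_mxM bar) trmx_mul mulmxA -(mulmxA T).
  have T'_unit : (map_mx bar T)^T \in unitmx by rewrite unitmx_tr map_unitmx.
  apply/eqP/eqP=> [->|]; first by rewrite mulmx1.
  by move/(can_inj (mulmxK T'_unit)); rewrite -[RHS]mulmx1 => /(can_inj (mulKmx T_unit)).
have [phi phiP phi_inj] := SU_anti_unitri3_cover d0 barD.
have iQ : unitri3 F \isog (unitri3_group E :&: SU_anti_group bar)%G.
  apply: (isog_of_covers (unitri3_cover F) phiP) => s t; split=> [|/phi_inj-> //].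
  case: s t => [[x1 y1] z1] [[x2 y2] z2] /u3_inj[/= ex ey ->]; congr (phi (_, _, _)).
    by apply/rowP=> i; rewrite ord1.
  by apply/rowP=> i; rewrite ord1.
have sylQ : p.-Sylow(SU_anti bar) (unitri3 E :&: SU_anti bar).
  apply: (unitri3_SU_anti_Sylow qbarK p_pr _ oE2 (a := 1) (b := - 2%:R^-1)).
  - by rewrite muln_gt0 n_gt0.
  - exact: oner_neq0.
  rewrite rmorphN fmorphV rmorph_nat rmorph1; field.
  exact: two_neq0 p_pr p_odd oE2.
have sylQx : p.-Sylow(S) ((unitri3_group E :&: SU_anti_group bar)%G :^ x).
  by rewrite SE pHallJ2.
have [y _ ->] := Sylow_trans sylQx sylP.
apply: isog_trans iQ (isog_trans (conj_isog _ x) (conj_isog _ y)).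
Qed.

End SpecialUnitary.

(** * Isometries of an alternating form *)

Section AlternatingForm.
Local Open Scope ring_scope.
Variables (F : finFieldType) (n : nat) (J : 'M[F]_n.+1).
Local Notation rV := 'rV[F]_n.+1.
Local Notation GL := {'GL_n.+1[F]}.
Local Notation mx g := (GLval g : 'M[F]_n.+1).
Implicit Types (u v w x d : rV) (a c : F) (g h : GL).

Definition altform u v : F := (u *m J *m v^T) 0 0.

Local Notation form := altform.

Lemma altformDl u u' v : form (u + u') v = form u v + form u' v.
Proof. by rewrite /altform !mulmxDl mxE. Qed.

Lemma altformDr u v v' : form u (v + v') = form u v + form u v'.
Proof. by rewrite /altform linearD mulmxDr mxE. Qed.

Lemma altformZl a u v : form (a *: u) v = a * form u v.
Proof. by rewrite /altform -!scalemxAl mxE. Qed.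

Lemma altformZr a u v : form u (a *: v) = a * form u v.
Proof. by rewrite /altform linearZ -scalemxAr mxE. Qed.

Lemma altformNr u v : form u (- v) = - form u v.
Proof. by rewrite -scaleN1r altformZr mulN1r. Qed.

Lemma altformNl u v : form (- u) v = - form u v.
Proof. by rewrite -scaleN1r altformZl mulN1r. Qed.

Lemma altform0l v : form 0 v = 0.
Proof. by rewrite -(scale0r (0 : rV)) altformZl mul0r. Qed.

Lemma altform0r v : form v 0 = 0.
Proof. by rewrite -(scale0r (0 : rV)) altformZr mul0r. Qed.

Definition altformE := (altformDl, altformDr, altformZl, altformZr, altformNl, altformNr).

Hypothesis J_alt : forall u, form u u = 0.
Hypothesis J_unit : J \in unitmx.

Lemma altformC u v : form v u = - form u v.
Proof.
apply: (addrI (form u v)); rewrite subrr.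
by have := J_alt (u + v); rewrite !altformE !J_alt add0r addr0.
Qed.

Lemma form_rank1 u v w : u *m (J *m v^T *m w) = form u v *: w.
Proof.
rewrite !mulmxA [u *m J *m v^T]mx11_scalar mul_scalar_mx //.
Qed.

Lemma form_nondegenerate u : u != 0 -> exists w, form u w != 0.
Proof.
move=> u0; apply/existsP; apply: contraR u0; rewrite negb_exists => /forallP u_perp.
have uJ : u *m J = 0.
  apply/rowP=> j; have := u_perp (delta_mx 0 j); rewrite negbK => /eqP.
  by rewrite /altform trmx_delta -colE !mxE.
by rewrite -[u](mulmxK J_unit) uJ mul0mx.
Qed.

Definition form_isometries : {set GL} :=
  [set g : GL | mx g *m J *m (mx g)^T == J].

Lemma form_isometries_group_set : group_set form_isometries.
Proof.
apply/group_setP; split=> [|g h].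
  by rewrite inE GL_1E trmx1 mul1mx mulmx1.
rewrite !inE => /eqP Hg /eqP Hh; apply/eqP.
by rewrite -[RHS]Hg -[in RHS]Hh GL_MxE trmx_mul !mulmxA.
Qed.

Canonical form_isometries_group := Group form_isometries_group_set.

Lemma form_isometry g u v : g \in form_isometries ->
  form (u *m mx g) (v *m mx g) = form u v.
Proof.
rewrite inE => /eqP Jg; rewrite /altform trmx_mul -[in RHS]Jg.
by rewrite !mulmxA.
Qed.

(** A map preserving a nondegenerate form is invertible. *)
Lemma isometry_exists (A : 'M[F]_n.+1) :
  (forall u v, form (u *m A) (v *m A) = form u v) ->
  exists2 g, g \in form_isometries & GLval g = A.
Proof.
move=> A_iso; have AJ : A *m J *m A^T = J.
  apply/matrixP=> i j; have := A_iso (delta_mx 0 i) (delta_mx 0 j).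
  have E (M : 'M[F]_n.+1) : ((delta_mx 0 i : rV) *m M *m (delta_mx 0 j : rV)^T) 0 0 = M i j.
    by rewrite -rowE trmx_delta -colE !mxE.
  by rewrite /altform trmx_mul -(E (A *m J *m A^T)) -(E J) !mulmxA.
have A_unit : A \is a GRing.unit.
  have : A *m (J *m A^T *m invmx J) = 1%:M by rewrite !mulmxA AJ mulmxV.
  by case/mulmx1_unit.
by exists (FinRing.Unit A_unit); rewrite // inE AJ.
Qed.

Lemma transvection_exists a d : exists2 g, g \in form_isometries &
  forall x, x *m mx g = x + (a * form x d) *: d.
Proof.
have tE x : x *m (1%:M + a *: (J *m d^T *m d)) = x + (a * form x d) *: d.
  by rewrite mulmxDr mulmx1 -scalemxAr form_rank1 scalerA.
have [u v|g Sg gE] := isometry_exists (A := 1%:M + a *: (J *m d^T *m d)).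
  by rewrite !tE !altformE J_alt (altformC v d); ring.
by exists g => // x; rewrite gE.
Qed.

(** If u and v are not orthogonal, the transvection along v - u carries u to v.
    Otherwise go through a vector w orthogonal to neither. Restricting the
    directions to D keeps everything orthogonal to D fixed; D is the whole space
    or the hyperplane orthogonal to a vector. *)
Lemma transvections_transitive (D : {set rV}) u v :
  {in D &, forall x y, x + y \in D} -> {in D &, forall x y, x - y \in D} ->
  u \in D -> v \in D ->
  (exists2 w, w \in D & form u w != 0) -> (exists2 w, w \in D & form v w != 0) ->
  exists g, [/\ g \in form_isometries, u *m mx g = v &
    forall x, {in D, forall d, form x d = 0} -> x *m mx g = x].
Proof.
move=> DD DB.
have direct u' v' : u' \in D -> v' \in D -> form u' v' != 0 ->
    exists g, [/\ g \in form_isometries, u' *m mx g = v' &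
      forall x, {in D, forall d, form x d = 0} -> x *m mx g = x].
  move=> Du Dv uv; have [g Sg gE] := transvection_exists (form u' v')^-1 (v' - u').
  exists g; split=> // [|x xD]; rewrite gE.
    by rewrite !altformE J_alt subr0 mulVf // scale1r addrC subrK.
  by rewrite xD ?DB // mulr0 scale0r addr0.
move=> Du Dv [w1 Dw1 uw1] [w2 Dw2 vw2].
(* If each of w1 and w2 fails on one side, their sum works on both. *)
have [w [Dw uw vw]] : exists w, [/\ w \in D, form u w != 0 & form v w != 0].
  have [vw1|vw1] := eqVneq (form v w1) 0; last by exists w1.
  have [uw2|uw2] := eqVneq (form u w2) 0; last by exists w2.
  by exists (w1 + w2); rewrite !altformDr uw2 vw1 addr0 add0r DD.
have [g [Sg ug fixg]] := direct _ _ Du Dw uw.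
have [|h [Sh wh fixh]] := direct _ _ Dw Dv; first by rewrite altformC oppr_eq0.
exists (g * h)%g; split=> [||x xD]; first exact: groupM.
  by rewrite GL_MxE mulmxA ug wh.
by rewrite GL_MxE mulmxA fixg ?fixh.
Qed.

Lemma isometries_transitive u v : u != 0 -> v != 0 ->
  exists2 g, g \in form_isometries & u *m mx g = v.
Proof.
move=> /form_nondegenerate[w uw] /form_nondegenerate[w' vw'].
have [||||||g [Sg ug _]] := @transvections_transitive [set: rV] u v.
all: try by [move=> *; rewrite inE | exists w | exists w' | rewrite inE].
by exists g.
Qed.

End AlternatingForm.

(** * Siegel transformations *)

Section SiegelTransformations.
Local Open Scope ring_scope.
Variables (F : finFieldType) (n : nat) (J : 'M[F]_n.+1).
Local Notation rV := 'rV[F]_n.+1.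
Local Notation GL := {'GL_n.+1[F]}.
Local Notation mx g := (GLval g : 'M[F]_n.+1).
Local Notation form := (altform J).
Local Notation isom := (form_isometries J).
Hypothesis J_alt : forall u : rV, form u u = 0.
Hypothesis J_unit : J \in unitmx.
Variable v : rV.
Hypothesis v0 : v != 0.
Implicit Types (u w x d : rV) (a c : F) (g h : GL).

(** The isometries fixing v and acting trivially on v^perp / v; for w in
    v^perp it sends x to x + (x, w) v + (x, v) w + c (x, v) v. *)
Definition siegel_mx w c : 'M[F]_n.+1 :=
  1%:M + (J *m w^T *m v + J *m v^T *m w + c *: (J *m v^T *m v)).

Lemma siegel_mxE x w c : x *m siegel_mx w c =
  x + (form x w *: v + form x v *: w + (c * form x v) *: v).
Proof.
by rewrite mulmxDr mulmx1 !mulmxDr -scalemxAr !form_rank1 scalerA.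
Qed.

Definition siegel w c : GL := insubd (1%g : GL) (siegel_mx w c).

Lemma siegel_isometry w c : form w v = 0 ->
  siegel w c \in isom /\ GLval (siegel w c) = siegel_mx w c.
Proof.
move=> wv; have [x y|g Sg gE] := isometry_exists J_unit (A := siegel_mx w c).
  rewrite !siegel_mxE !altformE !J_alt (altformC J_alt w v) wv.
  by rewrite (altformC J_alt y v) (altformC J_alt y w); ring.
suff -> : siegel w c = g by [].
by apply: val_inj; rewrite /siegel -gE val_insubd (valP g).
Qed.

Lemma siegelE x w c : form w v = 0 -> x *m mx (siegel w c) =
  x + (form x w *: v + form x v *: w + (c * form x v) *: v).
Proof. by case/(siegel_isometry c) => _ ->; apply: siegel_mxE. Qed.

Lemma GL_eq g h : (forall x, x *m mx g = x *m mx h) -> g = h.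
Proof. by move=> gh; apply/val_inj/row_matrixP=> i; rewrite !rowE gh. Qed.

Lemma perpD w w' : form w v = 0 -> form w' v = 0 -> form (w + w') v = 0.
Proof. by rewrite altformDl => -> ->; rewrite addr0. Qed.

Lemma siegelM w c w' c' : form w v = 0 -> form w' v = 0 ->
  (siegel w c * siegel w' c')%g = siegel (w + w') (c + c' + form w w').
Proof.
move=> wv w'v; apply: GL_eq => x.
have ww'v := perpD wv w'v; rewrite GL_MxE mulmxA !siegelE //.
rewrite !altformE J_alt (altformC J_alt w' v) wv w'v.
by apply/rowP=> i; rewrite !mxE; ring.
Qed.

(** The parameter w matters only modulo v. *)
Lemma siegel_line w c a : form w v = 0 ->
  siegel (w + a *: v) c = siegel w (c + 2%:R * a).
Proof.
move=> wv; apply: GL_eq => x.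
have wav : form (w + a *: v) v = 0 by rewrite !altformE wv J_alt mulr0 addr0.
rewrite !siegelE //.
by rewrite !altformE; apply/rowP=> i; rewrite !mxE; ring.
Qed.

Lemma siegel_inj w c w' c' : form w v = 0 -> form w' v = 0 ->
  siegel w c = siegel w' c' -> exists a, w' = w + a *: v.
Proof.
move=> wv w'v e; have [f vf] := form_nondegenerate J_unit v0.
have fv : form f v != 0 by rewrite (altformC J_alt) oppr_eq0.
have := congr1 (fun g => f *m mx g) e; rewrite !siegelE // => /addrI fe.
exists ((form f w + c * form f v - form f w' - c' * form f v) / form f v).
apply: (scalerI fv); apply: (addrI (form f w' *: v)).
apply: (addIr ((c' * form f v) *: v)); rewrite -fe scalerDr scalerA.
rewrite [form f v * (_ / _)]mulrC divfK //.
by apply/rowP=> i; rewrite !mxE; ring.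
Qed.

Lemma siegel_conj w c a g : g \in isom -> form w v = 0 -> v *m mx g = a *: v ->
  (siegel w c ^ g)%g = siegel (a *: (w *m mx g)) (a ^+ 2 * c).
Proof.
move=> Sg wv vg; apply: (mulgI g); rewrite conjgE !mulgA mulgV mul1g.
have wgv : form (a *: (w *m mx g)) v = 0.
  by rewrite altformZl -altformZr -vg form_isometry.
apply: GL_eq => x; rewrite !GL_MxE !mulmxA !siegelE //.
have xg y : a * form (x *m mx g) (y *m mx g) = a * form x y by rewrite form_isometry.
have xgv : form (x *m mx g) v * a = form x v.
  by rewrite mulrC -altformZr -vg form_isometry.
rewrite !mulmxDl -!scalemxAl vg !altformE form_isometry // scalerA -xgv.
by apply/rowP=> i; rewrite !mxE; ring.
Qed.

(** The orthogonal of a hyperplane is a line. *)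
Lemma perp_perp u : (forall w, form w v = 0 -> form u w = 0) -> exists a, u = a *: v.
Proof.
move=> u_perp; have [f vf] := form_nondegenerate J_unit v0.
exists (form u f / form v f); apply/eqP; rewrite -subr_eq0; apply/eqP/eqP/negPn/negP.
case/(form_nondegenerate J_unit)=> w /eqP[].
have : form u (w - (form v w / form v f) *: f) = 0.
  apply: u_perp; rewrite !altformE !(altformC J_alt v) -mulrN opprK.
  by rewrite divfK // addNr.
by rewrite !altformE => <-; field.
Qed.

Definition siegel_group : {set GL} :=
  [set g in isom | (v *m mx g == v) &&
    [forall u, (form u v == 0) ==> [exists a, u *m mx g == u + a *: v]]].

(** Pick f with (f, v) != 0; an element of the group is determined by its value
    at f, which gives w and c. Its effect on v^perp is then forced by
    invariance of the form. *)
Lemma siegel_groupP g : reflect (exists w c, form w v = 0 /\ g = siegel w c)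
  (g \in siegel_group).
Proof.
apply: (iffP idP) => [|[w [c [wv ->]]]]; last first.
  rewrite inE (siegel_isometry c wv).1 siegelE //= (altformC J_alt) wv J_alt.
  rewrite oppr0 mulr0 !scale0r !addr0 eqxx /=.
  apply/forallP=> u; apply/implyP=> /eqP uv; apply/existsP; exists (form u w).
  by rewrite siegelE // uv mulr0 !scale0r !addr0.
case/setIdP=> Sg /andP[/eqP vg /forallP perp_g].
have [f vf] := form_nondegenerate J_unit v0.
pose w := (form f v)^-1 *: (f *m mx g - f).
have fgv : form (f *m mx g) v = form f v by rewrite -{1}vg form_isometry.
have wv : form w v = 0 by rewrite /w !altformE fgv subrr mulr0.
have fv : form f v != 0 by rewrite (altformC J_alt) oppr_eq0.
have fgE : f *m mx g = f + form f v *: w.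
  by rewrite scalerA mulfV // scale1r addrC subrK.
clearbody w.
(* The coefficient is found by pairing with f before and after g. *)
have perpE u : form u v = 0 -> u *m mx g = u + form u w *: v.
  move=> uv; have /existsP[a /eqP ug] := implyP (perp_g u) (introT eqP uv).
  rewrite ug; congr (_ + _ *: _); apply: (mulIf fv).
  have := form_isometry u f Sg; rewrite ug fgE !altformE.
  rewrite (altformC J_alt w v) wv (altformC J_alt f v) => e.
  apply/eqP; rewrite -subr_eq0 -oppr_eq0; apply/eqP.
  by rewrite -(subrr (form u f)) -{1}e; ring.
exists w, (- form f w / form f v); split=> //; apply: GL_eq => x; rewrite siegelE //.
have {1}-> : x = (x - (form x v / form f v) *: f) + (form x v / form f v) *: f.
  by rewrite subrK.
rewrite mulmxDl -scalemxAl fgE perpE; last by rewrite !altformE divfK // subrr.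
by rewrite !altformE; apply/rowP=> i; rewrite !mxE; field.
Qed.

Lemma siegel_group_set : group_set siegel_group.
Proof.
apply/group_setP; split=> [|g h /siegel_groupP[w [c [wv ->]]] /siegel_groupP[w' [c' [w'v ->]]]].
  apply/siegel_groupP; exists 0, 0; rewrite altform0l; split=> //.
  apply: GL_eq => x; rewrite siegelE ?altform0l // mulmx1 altform0r scaler0 mul0r !scale0r.
  by rewrite !addr0.
apply/siegel_groupP; rewrite siegelM //.
exists (w + w'), (c + c' + form w w'); split=> //; exact: perpD.
Qed.

Canonical siegel_group_group := Group siegel_group_set.

Definition line_stab : {set GL} := [set g in isom | [exists a, v *m mx g == a *: v]].

Lemma line_stabP g : reflect (g \in isom /\ exists a, v *m mx g = a *: v) (g \in line_stab).
Proof.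
apply: (iffP setIdP) => [[Sg /existsP[a /eqP]]|[Sg [a vg]]].
  by split=> //; exists a.
by split=> //; apply/existsP; exists a; apply/eqP.
Qed.

Lemma line_stab_group_set : group_set line_stab.
Proof.
apply/group_setP; split=> [|g h /line_stabP[Sg [a vg]] /line_stabP[Sh [b vh]]].
  by apply/line_stabP; split; [apply: group1 | exists 1; rewrite mulmx1 scale1r].
apply/line_stabP; split; first exact: groupM.
by exists (a * b); rewrite GL_MxE mulmxA vg -scalemxAl vh scalerA.
Qed.

Canonical line_stab_group := Group line_stab_group_set.

Lemma siegel_normal : siegel_group <| line_stab.
Proof.
apply/andP; split.
  apply/subsetP=> _ /siegel_groupP[w [c [wv ->]]]; apply/line_stabP.
  split; first by case: (siegel_isometry c wv).
  by exists 1; rewrite siegelE // (altformC J_alt) wv J_alt oppr0 mulr0 !scale0r !addr0 scale1r.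
apply/subsetP=> g /line_stabP[Sg [a vg]]; rewrite inE.
apply/subsetP=> _ /imsetP[_ /siegel_groupP[w [c [wv ->]]] ->].
rewrite (siegel_conj c Sg wv vg).
apply/siegel_groupP; exists (a *: (w *m mx g)), (a ^+ 2 * c); split=> //.
by rewrite altformZl -altformZr -vg form_isometry.
Qed.

End SiegelTransformations.

(** * The p-core of a line stabilizer *)

Section LineStabilizerCore.
Local Open Scope ring_scope.
Variables (F : finFieldType) (n m : nat) (J : 'M[F]_n.+1).
Local Notation rV := 'rV[F]_n.+1.
Local Notation V2 := ('rV[F]_m * 'rV[F]_m)%type.
Local Notation GL := {'GL_n.+1[F]}.
Local Notation mx g := (GLval g : 'M[F]_n.+1).
Local Notation form := (altform J).
Local Notation isom := (form_isometries J).
Hypothesis J_alt : forall u : rV, form u u = 0.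
Hypothesis J_unit : J \in unitmx.
Variable v : rV.
Hypothesis v0 : v != 0.
Local Notation siegel := (siegel J v).
Local Notation Q := (siegel_group J v).
Implicit Types (u w x : rV) (a c : F) (g h : GL).
Variables (p e : nat) (i0 : 'I_m).
Hypotheses (p_pr : prime p) (p_odd : odd p) (oF : #|F| = (p ^ e)%N).
Variable W : V2 -> rV.
Hypotheses (WD : {morph W : s t / s + t}) (W_perp : forall s, form (W s) v = 0).
Hypothesis W_form : forall s t, form (W s) (W t) = symp s t.
Hypothesis W_span : forall w, form w v = 0 -> exists s a, w = W s + a *: v.

(** W is injective modulo v, because it carries the nondegenerate pairing to
    the form. *)
Lemma W_free s t a : W t = W s + a *: v -> s = t.
Proof.
move=> st; apply/eqP; rewrite -subr_eq0; apply/eqP/symp_nondegenerate=> r.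
rewrite sympDl -scaleN1r sympZl mulN1r -!W_form st !altformE.
by rewrite [form v _](altformC J_alt) W_perp oppr0 mulr0 addr0 subrr.
Qed.

Lemma siegel_inj_scalar w c c' : form w v = 0 -> siegel w c = siegel w c' -> c = c'.
Proof.
move=> wv E; have [f vf] := form_nondegenerate J_unit v0.
have fv : form f v != 0 by rewrite (altformC J_alt) oppr_eq0.
have := congr1 (fun g => f *m mx g) E; rewrite /= !siegelE // => /addrI/addrI/eqP.
rewrite -subr_eq0 -scalerBl -mulrBl scaler_eq0 mulf_eq0 (negPf v0) (negPf fv) !orbF.
by rewrite subr_eq0 => /eqP.
Qed.

(** Siegel transformations multiply with the alternating cocycle; the shift by
    2 z - x.y turns it into that of [hmul], as p is odd. *)
Definition heis_siegel (t : heis F m) : GL :=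
  siegel (W t.1) (2%:R * t.2 - dot t.1.1 t.1.2).

Lemma heis_siegel_cover : magma_cover (@hmul F m) Q heis_siegel.
Proof.
split=> [t|g|s t].
- by apply/(siegel_groupP J_alt J_unit v0); exists (W t.1), (2%:R * t.2 - dot t.1.1 t.1.2).
- case/(siegel_groupP J_alt J_unit v0)=> w [c [wv ->]].
  have [[x y] [a ->]] := W_span wv; rewrite siegel_line //.
  exists (Heis x y ((c + 2%:R * a + dot x y) / 2%:R)); congr siegel.
  by rewrite /=; field; exact: two_neq0 p_pr p_odd oF.
rewrite /heis_siegel siegelM // W_form -WD; congr siegel.
by rewrite /hmul /symp /= dotDl !dotDr; ring.
Qed.

Lemma heis_siegel_inj : injective heis_siegel.
Proof.
move=> s t st; have [a /W_free e1] := siegel_inj J_alt J_unit v0 (W_perp _) (W_perp _) st.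
move: st; rewrite /heis_siegel -e1 => /siegel_inj_scalar-/(_ (W_perp _)) /addIr.
move/(mulfI (two_neq0 p_pr p_odd oF)); case: s t e1 => [[x y] z] [[x' y'] z'] /= [-> ->] -> //.
Qed.

Lemma extraspec_siegel_isog : extraspec F m \isog siegel_group_group J_alt J_unit v0.
Proof.
apply: (isog_of_covers (extraspec_cover F i0) heis_siegel_cover) => s t.
by split=> [/extraspec_elt_inj->|/heis_siegel_inj->].
Qed.

Lemma siegel_pgroup : p.-group Q.
Proof.
rewrite /pgroup -(card_isog extraspec_siegel_isog) (card_extraspec F i0) oF.
by rewrite !pnatX pnat_id.
Qed.

Local Notation S := (line_stab_group J v).
Local Notation Qg := (siegel_group_group J_alt J_unit v0).

Lemma siegel_center_line a c : siegel (a *: v) c \in 'Z(Qg).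
Proof.
have av : form (a *: v) v = 0 by rewrite altformZl J_alt mulr0.
apply/centerP; split=> [|_ /(siegel_groupP J_alt J_unit v0)[w [c' [wv ->]]]].
  by apply/(siegel_groupP J_alt J_unit v0); exists (a *: v), c.
rewrite /commute !siegelM // altformZl altformZr wv (altformC J_alt w v) wv oppr0.
by rewrite [w + _]addrC [c' + _]addrC !mulr0.
Qed.

(** Commuting with all Siegel transformations means 2 (w, w') = 0 for all w' in
    v^perp. *)
Lemma siegel_centerP w c : form w v = 0 -> siegel w c \in 'Z(Qg) ->
  exists a, w = a *: v.
Proof.
move=> wv /centerP[_ Zw]; apply: (perp_perp J_alt J_unit v0) => w' w'v.
have Qw' : siegel w' 0 \in Qg.
  by apply/(siegel_groupP J_alt J_unit v0); exists w', 0.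
have := Zw _ Qw'; rewrite /commute !siegelM // [w' + w]addrC.
move/(siegel_inj_scalar (perpD wv w'v)); rewrite (altformC J_alt w w') addr0 add0r.
move/addrI/eqP; rewrite -addr_eq0 -mulr2n -mulr_natl mulf_eq0.
by rewrite (negPf (two_neq0 p_pr p_odd oF)) => /eqP.
Qed.

(** An eigenvalue of a p-element is a root of X^(p^k) - 1 = (X - 1)^(p^k). *)
Lemma p_elt_fix_line g a : p.-elt g -> v *m mx g = a *: v -> v *m mx g = v.
Proof.
move=> pg vg; have vgk k : v *m mx (g ^+ k)%g = a ^+ k *: v.
  elim: k => [|k IH]; first by rewrite mulmx1 scale1r.
  by rewrite expgSr GL_MxE mulmxA IH -scalemxAl vg scalerA -exprSr.
have [k gk] := p_natP pg.
have ak : a ^+ (p ^ k) = 1.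
  have /eqP := vgk (p ^ k)%N; rewrite -gk expg_order mulmx1 -subr_eq0.
  rewrite -[X in X - _]scale1r -scalerBl scaler_eq0 (negPf v0) orbF subr_eq0 gk.
  by move/eqP.
have pF := card_finPcharP oF p_pr.
have pk : [pchar F].-nat (p ^ k)%N by rewrite pnatX (eq_pnat _ (pcharf_eq pF)) pnat_id.
have : (a - 1) ^+ (p ^ k) = 0.
  by apply: (addIr 1); rewrite -[X in _ + X = _](expr1n _ (p ^ k)) -exprDn_pchar // subrK add0r.
by move/eqP; rewrite expf_eq0 subr_eq0 => /andP[_ /eqP a1]; rewrite vg a1 scale1r.
Qed.

(** Transvections along v^perp fix v, and the form restricted to v^perp has
    radical the line of v. *)
Lemma line_stab_transitive u w : form u v = 0 -> form w v = 0 ->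
  (forall a, u != a *: v) -> (forall a, w != a *: v) ->
  exists g, [/\ g \in S, u *m mx g = w & v *m mx g = v].
Proof.
move=> uv wv uNv wNv.
have nondeg x : (forall a, x != a *: v) ->
    exists2 y, y \in [set y | form y v == 0] & form x y != 0.
  move=> xNv.
  have [/existsP[y /andP[yv xy]]|] :=
    boolP [exists y, (form y v == 0) && (form x y != 0)].
    by exists y; rewrite ?inE.
  rewrite negb_exists => /forallP x_perp.
  have [|a xa] := perp_perp J_alt J_unit v0 (u := x).
    by move=> y yv; have := x_perp y; rewrite yv eqxx negbK => /eqP.
  by have := xNv a; rewrite xa eqxx.
have [||||||g [Sg ug fixg]] := @transvections_transitive _ _ J J_alt J_unit
  [set y | form y v == 0] u w.
- by move=> x y; rewrite !inE altformDl => /eqP-> /eqP->; rewrite addr0.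
- by move=> x y; rewrite !inE !altformE => /eqP-> /eqP->; rewrite subr0.
- by rewrite inE uv.
- by rewrite inE wv.
- exact: nondeg.
- exact: nondeg.
have vg : v *m mx g = v.
  by apply: fixg => d; rewrite inE (altformC J_alt d v) => /eqP->; rewrite oppr0.
exists g; split=> //; apply/line_stabP; split=> //.
by exists 1; rewrite vg scale1r.
Qed.

(** The p-core R contains Q and fixes v. An element of Q whose class is central
    in R / Z(Q) gives a vector w0 of v^perp, outside the line of v, that R fixes
    modulo v. As R is normal in the stabilizer, which is transitive on such
    vectors, R fixes all of them modulo v, so R is contained in Q. *)
Lemma pcore_line_stab : 'O_p(S) = Q :> {set GL}.
Proof.
set R := 'O_p(S)%G.
have pR : p.-group R := pcore_pgroup p S.
have [sRS nRS] := andP (pcore_normal p S : R <| S).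
have [sQS nQS] := andP (siegel_normal J_alt J_unit v0).
have sQR : Qg \subset R.
  by apply: pcore_max; [exact: siegel_pgroup | exact: siegel_normal].
have R_fix r : r \in R -> v *m mx r = v.
  move=> Rr; have /line_stabP[_ [a vr]] := subsetP sRS r Rr.
  exact: p_elt_fix_line (mem_p_elt pR Rr) vr.
have nsQR : Qg <| R by rewrite /normal sQR (subset_trans sRS nQS).
have nsZR : 'Z(Qg) <| R := gFnormal_trans _ nsQR.
(* From a nontrivial element of Q / Z(Q) that is central in R / Z(Q). *)
have [w0 [w0v w0Nv w0R]] : exists w, [/\ form w v = 0, forall a, w != a *: v
    & forall r, r \in R -> exists a, w *m mx r = w + a *: v].
  have : ((Qg / 'Z(Qg)) :&: 'Z(R / 'Z(Qg)))%g != 1%g.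
    apply: meet_center_nil; first exact/quotient_nil/(pgroup_nil pR).
      exact: quotient_normal.
    rewrite -subG1 quotient_sub1 ?gFnorm //; apply/negP=> QZ.
    have W1 := siegel_centerP (W_perp (delta_mx 0 i0, 0)) (subsetP QZ (siegel (W _) 0) _).
    case: W1 => [|a Wa].
      by apply/(siegel_groupP J_alt J_unit v0); exists (W (delta_mx 0 i0, 0)), 0.
    have := W_form (delta_mx 0 i0, 0) (0, delta_mx 0 i0).
    rewrite Wa altformZl (altformC J_alt) W_perp oppr0 mulr0 /symp /= dot_delta dot0l subr0.
    by rewrite mxE !eqxx => /eqP; rewrite eq_sym oner_eq0.
  case/trivgPn=> _ /setIP[/morphimP[x Nx Qx ->] /centerP[_ Zx]] X1.
  have /(siegel_groupP J_alt J_unit v0)[w [c [wv xE]]] := Qx; exists w; split=> //.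
    move=> a; apply: contraNneq X1 => wa; apply/eqP/coset_id.
    by rewrite xE wa siegel_center_line.
  move=> r Rr; have Nr : r \in 'N('Z(Qg)) by apply: subsetP (normal_norm nsZR) r Rr.
  have xr : (x^-1 * x ^ r)%g \in 'Z(Qg).
    apply: coset_idr; first by rewrite groupM ?groupV ?groupJ.
    rewrite morphM ?groupV ?groupJ // morphV // morphJ //.
    have -> : (coset 'Z(Qg) x ^ coset 'Z(Qg) r)%g = coset 'Z(Qg) x.
      by apply/conjg_fixP/commgP; apply: Zx; apply: mem_quotient.
    exact: mulVg.
  have /(siegel_groupP J_alt J_unit v0)[w' [c' [w'v zE]]] := subsetP (center_sub _) _ xr.
  have [b w'b] := siegel_centerP w'v (etrans (congr1 (fun z => z \in 'Z(Qg)) (esym zE)) xr).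
  have := mulKVg x (x ^ r)%g; rewrite zE xE siegelM //.
  have Sr : r \in isom by have /line_stabP[] := subsetP sRS r Rr.
  rewrite (siegel_conj J_alt J_unit c (a := 1) Sr wv) ?scale1r ?R_fix //.
  case/(siegel_inj J_alt J_unit v0)=> [||a ->].
  - exact: perpD.
  - by rewrite -{1}(R_fix r Rr) form_isometry.
  by exists (b + a); rewrite w'b -addrA scalerDl.
apply/eqP; rewrite eqEsubset sQR andbT; apply/subsetP=> r Rr.
have [Sr _] := line_stabP _ _ _ (subsetP sRS r Rr).
apply/setIdP; split=> //; apply/andP; split; first by rewrite R_fix.
apply/forallP=> u; apply/implyP=> /eqP uv; apply/existsP.
have [/existsP[a /eqP ua]|] := boolP [exists a, u == a *: v].
  by exists 0; rewrite ua -scalemxAl R_fix // scale0r addr0.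
rewrite negb_exists => /forallP uNv.
have [g [Sg w0g vg]] := line_stab_transitive w0v uv w0Nv uNv.
(* R is normal, so the conjugate of r by g^-1 fixes w0 modulo v. *)
have [a w0r] : exists a, w0 *m mx (r ^ g^-1)%g = w0 + a *: v.
  have nRg : g^-1%g \in 'N(R) by rewrite groupV (subsetP nRS).
  by apply: w0R; rewrite memJ_norm.
exists a; rewrite -w0g; apply/eqP.
have rg : (r ^ g^-1 * g = g * r)%g by rewrite conjgE invgK !mulgA mulgKV.
have : w0 *m mx (r ^ g^-1)%g *m mx g = w0 *m mx g *m mx r.
  rewrite -[LHS]mulmxA -[RHS]mulmxA; congr (_ *m _).
  by apply: (congr1 (fun h : GL => mx h) rg).
by rewrite w0r mulmxDl -scalemxAl vg => <-.
Qed.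

End LineStabilizerCore.

(** * Passing to the projective group *)

(** A p-subgroup of G / Z lifts to P x Z with P a p-group, since Z is a central
    p'-group. *)
Lemma pcore_quotient_p'center (gT : finGroupType) (p : nat) (G Z : {group gT}) :
  Z \subset 'Z(G) -> (p^').-group Z -> 'O_p(G) \isog 'O_p(G / Z).
Proof.
move=> sZ p'Z; have nsZ : Z <| G := sub_center_normal sZ.
have [sZG nZG] := andP nsZ.
have sOO : 'O_p(G) / Z \subset 'O_p(G / Z) := morphim_pcore _ _ _.
suff -> : 'O_p(G / Z) = 'O_p(G) / Z.
  apply: quotient_isog; first exact: subset_trans (pcore_sub _ _) nZG.
  by rewrite setIC coprime_TIg // (pnat_coprime (pcore_pgroup p G)).
apply/eqP; rewrite eqEsubset sOO andbT.
have [X XE sZX nsX] := inv_quotientN nsZ (pcore_normal p (G / Z)).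
have nZX := subset_trans (normal_sub nsX) nZG.
have pX : p.-group (X / Z) by rewrite -XE pcore_pgroup.
have [P sylP] := Sylow_exists p X; have sPX := pHall_sub sylP.
have PE : X / Z = P / Z.
  by rewrite [RHS](pHall_id (quotient_pHall (subset_trans sPX nZX) sylP) pX).
have nPX : P <| X.
  rewrite /normal sPX; have : X \subset (Z * P)%g by rewrite -quotientSK // PE.
  move/subset_trans; apply; rewrite mul_subG ?normG //.
  apply: subset_trans sZ _; apply: subset_trans (cent_sub P).
  apply: subset_trans (subsetIr _ _) (centS _).
  exact: subset_trans sPX (normal_sub nsX).
rewrite XE PE quotientS // pcore_max ?(pHall_pgroup sylP) //.
by rewrite -(normal_Hall_pcore sylP nPX) gFnormal_trans.
Qed.

Section CenterOfIsometries.
Local Open Scope ring_scope.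
Variables (F : finFieldType) (n : nat) (J : 'M[F]_n.+1).
Local Notation rV := 'rV[F]_n.+1.
Local Notation GL := {'GL_n.+1[F]}.
Local Notation mx g := (GLval g : 'M[F]_n.+1).
Local Notation form := (altform J).
Local Notation isom := (form_isometries_group J).
Hypothesis J_alt : forall u : rV, form u u = 0.
Hypothesis J_unit : J \in unitmx.
Implicit Types (u v w x d : rV) (a c : F) (z g : GL).

(** An isometry commuting with the transvection along d fixes the line of d. *)
Lemma center_isometries_line z d : z \in 'Z(isom) -> exists a, d *m mx z = a *: d.
Proof.
case/centerP=> Sz cz; have [->|d0] := eqVneq d 0.
  by exists 0; rewrite mul0mx scaler0.
have [x dx] := form_nondegenerate J_unit d0.
have xd : form x d != 0 by rewrite (altformC J_alt) oppr_eq0.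
have [t St tE] := transvection_exists J_alt J_unit 1 d.
have : x *m mx z *m mx t = x *m mx t *m mx z.
  rewrite -[LHS]mulmxA -[RHS]mulmxA; congr (_ *m _).
  by apply: (congr1 (fun h : GL => mx h) (cz t St)).
rewrite !tE !mul1r mulmxDl -scalemxAl => /addrI zd.
by exists (form (x *m mx z) d / form x d); rewrite mulrC -scalerA zd scalerA mulVf // scale1r.
Qed.

(** Let z scale d by a. On a vector w not orthogonal to d, and on w + d, it must
    act by a^-1; comparing w and w + d gives a^-1 = a. *)
Lemma center_isometries_involution z : z \in 'Z(isom) -> (z * z = 1)%g.
Proof.
move=> Zz; have [Sz _] := centerP _ _ Zz; apply: GL_eq => d.
rewrite GL_MxE mulmxA mulmx1; have [->|d0] := eqVneq d 0; first by rewrite !mul0mx.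
have [w dw] := form_nondegenerate J_unit d0.
have [a da] := center_isometries_line d Zz; have [b wb] := center_isometries_line w Zz.
have [c dwc] := center_isometries_line (w + d) Zz.
have ab : a * b = 1.
  apply: (mulIf dw); rewrite mul1r -[in RHS](form_isometry d w Sz) da wb !altformE.
  by rewrite mulrA.
have ac : a * c = 1.
  apply: (mulIf dw); rewrite mul1r -mulrA; transitivity (form d (w + d)); last first.
    by rewrite altformDr J_alt addr0.
  rewrite -[RHS](form_isometry _ _ Sz) da dwc !altformE J_alt.
  by rewrite addr0.
have a0 : a != 0 by apply: contra_eq_neq ab => ->; rewrite mul0r eq_sym oner_eq0.
have bc : b = c by apply: (mulfI a0); rewrite ab ac.
have ba : b = a.
  move: dwc; rewrite mulmxDl da wb -bc scalerDr => /addrI/eqP.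
  by rewrite -subr_eq0 -scalerBl scaler_eq0 (negPf d0) orbF subr_eq0 => /eqP.
by rewrite da -scalemxAl da scalerA -{2}ba ab scale1r.
Qed.

Lemma center_isometries_p' p : prime p -> odd p -> (p^').-group 'Z(isom).
Proof.
move=> p_pr p_odd; rewrite /pgroup p'natE //; apply/negP=> /(Cauchy p_pr)[z Zz oz].
have : (#[z] %| 2)%N by rewrite order_dvdn expgS expg1 center_isometries_involution.
by rewrite oz dvdn_prime2 // => /eqP p2; rewrite p2 in p_odd.
Qed.

End CenterOfIsometries.

(** * The symplectic group *)

Section SymplecticGroup.
Local Open Scope ring_scope.
Variables (F : finFieldType) (m : nat).
Local Notation N := (m.+1 + m.+1)%N.
Local Notation n := (m + m.+1)%N.
Local Notation V2 := ('rV[F]_m * 'rV[F]_m)%type.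
Local Notation J := (symp_gram F m : 'M[F]_n.+1).
Local Notation form := (@altform F n J).

Lemma form_row_mx (a b a' b' : 'rV[F]_m.+1) :
  form (row_mx a b) (row_mx a' b') = symp (a, b) (a', b').
Proof.
rewrite /altform /symp_gram (mul_row_block a b 0 1%:M (- 1%:M) 0).
rewrite !mulmx0 mulmx1 mulmxN mulmx1 add0r addr0 (tr_row_mx a' b').
rewrite (mul_row_col (- b) a) mulNmx addrC !mxE /symp /dot; congr (_ - _).
  by apply: eq_bigr => i _; rewrite mxE.
by apply: eq_bigr => i _; rewrite mxE mulrC.
Qed.

Lemma symp_gram_alt (u : 'rV[F]_n.+1) : form u u = 0.
Proof.
rewrite -[u](hsubmxK (u : 'rV[F]_N)) form_row_mx /symp /=.
by rewrite subrr.
Qed.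

Lemma symp_gram_unit : J \in unitmx.
Proof.
have : symp_gram F m *m - symp_gram F m = 1%:M.
  rewrite mulmxN /symp_gram mulmx_block !mulmx0 !mul0mx !mulmx1 !mul1mx.
  by rewrite !addr0 !add0r opp_block_mx opprK oppr0 -scalar_mx_block.
by case/mulmx1_unit.
Qed.

(** Prepends a zero coordinate. *)
Definition ext0 (x : 'rV[F]_m) : 'rV[F]_m.+1 :=
  \row_i (if unlift ord0 i is Some j then x 0 j else 0).

Lemma dot_ext0 x y : dot (ext0 x) y = \sum_i x 0 i * y 0 (lift ord0 i).
Proof.
rewrite /dot big_ord_recl mxE unlift_none mul0r add0r.
by apply: eq_bigr => i _; rewrite mxE liftK.
Qed.

Lemma dot_ext0_ext0 x y : dot (ext0 x) (ext0 y) = dot x y.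
Proof. by rewrite dot_ext0; apply: eq_bigr => i _; rewrite mxE liftK. Qed.

(** The first vector of the standard symplectic basis; [std_perp] below
    parametrizes a complement of its line in its orthogonal hyperplane. *)
Definition std_line : 'rV[F]_n.+1 := row_mx (delta_mx 0 ord0 : 'rV[F]_m.+1) 0.

Definition std_perp (s : V2) : 'rV[F]_n.+1 := row_mx (ext0 s.1) (ext0 s.2).

Lemma std_line_neq0 : std_line != 0.
Proof.
apply/eqP=> /(congr1 (fun u : 'rV[F]_N => lsubmx u)).
by rewrite row_mxKl => /rowP/(_ ord0); rewrite !mxE !eqxx => /eqP; rewrite oner_eq0.
Qed.

Lemma ext0D : {morph ext0 : x y / x + y}.
Proof.
by move=> x y; apply/rowP=> i; rewrite !mxE; case: unlift => [j|]; rewrite ?mxE ?addr0.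
Qed.

Lemma row_mxD (a b c d : 'rV[F]_m.+1) :
  row_mx a b + row_mx c d = row_mx (a + c) (b + d) :> 'rV[F]_n.+1.
Proof. exact: (add_row_mx a b c d). Qed.

Lemma std_perpD : {morph std_perp : s t / s + t}.
Proof.
by move=> s t; rewrite /std_perp row_mxD -!ext0D.
Qed.

Lemma std_perp_form s t : form (std_perp s) (std_perp t) = symp s t.
Proof. by rewrite form_row_mx /symp /= !dot_ext0_ext0. Qed.

Lemma ext0_decomp (a : 'rV[F]_m.+1) :
  a = ext0 (\row_i a 0 (lift ord0 i)) + a 0 ord0 *: delta_mx 0 ord0.
Proof.
apply/rowP=> i; rewrite !mxE; case: unliftP => [j ->|->] /=.
  by rewrite mxE mulr0 addr0.
by rewrite mulr1 add0r.
Qed.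

Lemma std_perp_line s : form (std_perp s) std_line = 0.
Proof.
by rewrite form_row_mx /symp /= dot0r dotC dot_delta mxE unlift_none subrr.
Qed.

Lemma std_perp_span w : form w std_line = 0 -> exists s a, w = std_perp s + a *: std_line.
Proof.
rewrite -[w](hsubmxK (w : 'rV[F]_N)); set a := lsubmx _; set b := rsubmx _.
rewrite form_row_mx /symp /= dot0r sub0r dotC dot_delta => /eqP; rewrite oppr_eq0 => /eqP b0.
exists (\row_i a 0 (lift ord0 i), \row_i b 0 (lift ord0 i)), (a 0 ord0).
have -> : a 0 ord0 *: std_line = row_mx (a 0 ord0 *: delta_mx 0 ord0) 0 :> 'rV[F]_n.+1.
  have := scale_row_mx (a 0 ord0) (delta_mx 0 ord0 : 'rV[F]_m.+1) (0 : 'rV[F]_m.+1).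
  by rewrite [a 0 ord0 *: (0 : 'rV[F]_m.+1)]scaler0 => <-.
have bE : b = ext0 (\row_i b 0 (lift ord0 i)).
  by rewrite [LHS]ext0_decomp b0 scale0r addr0.
by rewrite row_mxD addr0 -ext0_decomp -bE.
Qed.

Local Notation GL := {'GL_n.+1[F]}.
Local Notation mx g := (GLval g : 'M[F]_n.+1).

Lemma dim1_line (A : {vspace 'rV[F]_n.+1}) : \dim A = 1%N ->
  exists2 v, v != 0 & forall u, (u \in A) = [exists a, u == a *: v].
Proof.
move=> dimA; exists (vpick A); first by rewrite vpick0 -dimv_eq0 dimA.
have AE : A = <[vpick A]>%VS.
  apply/eqP; rewrite eq_sym eqEdim -memvE memv_pick dimA dim_vline vpick0.
  by rewrite -dimv_eq0 dimA.
move=> u; rewrite {1}AE; apply/vlineP/existsP=> [[a ->]|[a /eqP->]]; by exists a.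
Qed.

(** The center fixes every line, so it acts trivially on the set of vectors of
    A, and stabilizers can be computed before taking the quotient. *)
Lemma PSp_stab_quotient (A : {vspace 'rV[F]_n.+1}) v : v != 0 ->
  (forall u, (u \in A) = [exists a, u == a *: v]) ->
  PSp_stab A = (line_stab J v / 'Z(Sp F m))%g.
Proof.
move=> v0 AE; rewrite /PSp_stab /PGL_act.
set X := [set u | _].
have vP u : reflect (exists a, u = a *: v) (u \in X).
  by rewrite inE AE; apply: (iffP existsP) => [[a /eqP]|[a ->]]; exists a.
have stabE (g : GL) : (g \in 'C[X | ('MR (GLrepr F n))^*])%act =
    [exists a, v *m mx g == a *: v].
  apply/astab1P/existsP=> [|[a /eqP vg]].
    rewrite /= setactE => gX.
    have : v *m mx g \in X.
      rewrite -gX; apply/imsetP; exists v; last by rewrite /= mx_repr_actE ?inE.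
      by apply/vP; exists 1; rewrite scale1r.
    by case/vP=> a va; exists a; rewrite va.
  apply/eqP; rewrite /= setactE eqEcard card_imset; last first.
    by move=> u w; apply: (act_inj ('MR (GLrepr F n)) g).
  rewrite leqnn andbT; apply/subsetP=> _ /imsetP[_ /vP[b ->] ->].
  by apply/vP; exists (b * a); rewrite /= mx_repr_actE ?inE // -scalemxAl vg scalerA.
have cZ : 'Z(Sp F m)%G \subset ('C([set X] | ('MR (GLrepr F n))^*))%act.
  apply/subsetP=> z Zz; rewrite stabE; apply/existsP.
  have [a za] := center_isometries_line symp_gram_alt (symp_gram_unit) v Zz.
  by exists a; rewrite za.
have -> : line_stab J v = Sp F m :&: ('C[X | ('MR (GLrepr F n))^*])%act.
  by apply/setP=> g; rewrite inE [RHS]inE stabE.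
rewrite astab_mod //; apply: esym; apply: quotientGI; exact: center_sub.
Qed.

(** Transitivity on nonzero vectors carries the standard symplectic basis to
    one starting with a spanning vector of A, which provides the parameters W. *)
Lemma extraspec_pcore_PSp_stab (p e : nat) (A : {vspace 'rV[F]_n.+1}) :
  prime p -> odd p -> #|F| = (p ^ e)%N -> (0 < m)%N -> \dim A = 1%N ->
  extraspec F m \isog 'O_p(PSp_stab A).
Proof.
move=> p_pr p_odd oF m_gt0 /dim1_line[v v0 AE].
have Ja := symp_gram_alt; have Ju := symp_gram_unit.
rewrite (PSp_stab_quotient v0 AE).
have [h Sh vh] := isometries_transitive Ja Ju (std_line_neq0) v0.
pose W s := std_perp s *m mx h.
have WD : {morph W : s t / s + t} by move=> s t; rewrite /W std_perpD mulmxDl.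
have W_perp s : form (W s) v = 0 by rewrite -vh form_isometry // std_perp_line.
have W_form s t : form (W s) (W t) = symp s t.
  by rewrite form_isometry // std_perp_form.
have W_span w : form w v = 0 -> exists s a, w = W s + a *: v.
  move=> wv; have wE : w = (w *m mx h^-1%g) *m mx h.
    have hh : mx h^-1%g *m mx h = 1%:M := congr1 (fun g : GL => mx g) (mulVg h).
    by rewrite -[RHS]mulmxA hh mulmx1.
  have [|s [a ws]] := @std_perp_span (w *m mx h^-1%g).
    by rewrite -(form_isometry _ _ Sh) -wE vh.
  by exists s, a; rewrite wE ws mulmxDl -scalemxAl vh.
pose i0 := Ordinal m_gt0.
have isoQ := extraspec_siegel_isog Ja Ju v0 i0 p_pr p_odd oF WD W_perp W_form W_span.
have OQ := pcore_line_stab Ja Ju v0 i0 p_pr p_odd oF WD W_perp W_form W_span.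
apply: isog_trans isoQ _; rewrite -[X in X \isog _]/(siegel_group J v) -OQ.
apply: pcore_quotient_p'center; last exact: (center_isometries_p' Ja Ju p_pr p_odd).
rewrite subsetI; apply/andP; split; last first.
  apply: subset_trans (subsetIr _ _) (centS _).
  by apply/subsetP=> g /line_stabP[].
apply/subsetP=> z Zz; apply/line_stabP; split; first by case/centerP: Zz.
exact: center_isometries_line Zz.
Qed.

End SymplecticGroup.

(** * Central quotients, Sylow subgroups and point stabilizers *)

Theorem theorem3 (p n m : nat) (F : finFieldType)
    (p_pr : prime p) (p_odd : odd p) (n_gt0 : 0 < n) (m_gt0 : 0 < m)
    (cardF : #|F| = p ^ n) :
  [/\ (* (i) *)
      forall (i : 'I_m) (U : {group extraspec_type F m}) (d : nat)
             (F0 : finFieldType),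
        U \proper 'Z(extraspec F m) -> d %| n -> #|F0| = p ^ d ->
        (subfield_hyperplane (card_finPcharP cardF p_pr) d (center_preim i U)
         <-> (extraspec F m / U)%g \isog extraspec F0 (m * (n %/ d))),
      forall U : {group extraspec_type F m},
        U \subset 'Z(extraspec F m) -> #|U| = p ^ n.-1 ->
        (extraspec F m / U)%g \isog extraspec 'F_p (m * n),
      (* (ii) *)
      forall P : {group {'GL_3[F]}},
        p.-Sylow(SL F 3) P -> unitri3 F \isog P,
      forall (E : finFieldType) (P : {group {'GL_3[E]}}),
        #|E| = (p ^ n) ^ 2 -> p.-Sylow(SU E 3 (p ^ n)) P -> unitri3 F \isog P
    & (* (iii) *)
      forall A : {vspace 'rV[F]_(m.+1 + m.+1)},
        \dim A = 1 -> extraspec F m \isog 'O_p(PSp_stab A)].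
Proof.
split.
- move=> i U d F0 UpZ dn oF0; split.
    exact: subfield_hyperplane_isog (proper_sub UpZ).
  exact: isog_subfield_hyperplane.
- by move=> U UZ oU; apply: central_hyperplane_isog cardF U n_gt0 m_gt0 UZ oU.
- by move=> P; apply: Sylow_SL3_isog n_gt0 cardF P.
- by move=> E P oE; apply: (Sylow_SU3_isog p_pr p_odd n_gt0 cardF oE).
by move=> A; apply: extraspec_pcore_PSp_stab cardF m_gt0.
Qed.
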